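(* Let $\mathcal{H}$ be a separable infinite-dimensional Hilbert space, let $S\in L(\mathcal{H})$ be a bounded positive invertible operator, and let $\mathbf{c}=(c_i)_{i\in\mathbb{N}}$ be a bounded sequence of non negative real numbers such that $\sum_{i\in\mathbb{N}}c_i=\infty$. Let $E$ be the spectral measure of $S$ and $P_2(S)=E[\,\|S\|_e,\|S\|\,]$. Assume one of the following two conditions: 1. (a) $\operatorname{tr}P_2(S)=\infty$, (b) $U_k(S)\ge U_k(\mathbf{c})$ for every $k\in\mathbb{N}$, and (c) $\|S\|_e>\limsup(\mathbf{c})$. 2. (a) $\operatorname{tr}P_2(S)=r$ for some $r\in\mathbb{N}\cup\{0\}$, (b) $U_k(S)\ge U_k(\mathbf{c})$ for $1\le k\le r$, (c) $U_k(S)>U_k(\mathbf{c})$ for every $k>r$, and (d) $\|S\|_e>\limsup(\mathbf{c})$. Then the pair $(S,\mathbf{c})$ is frame admissible.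
   Context: Hilbert spaces are complex; $\mathbb{N}=\{1,2,\dots\}$. A sequence $\{f_i\}_{i\in\mathbb{N}}$ in $\mathcal{H}$ is a frame for $\mathcal{H}$ if there are constants $A,B>0$ with $A\|x\|^2\le\sum_{i\in\mathbb{N}}|\langle x,f_i\rangle|^2\le B\|x\|^2$ for all $x\in\mathcal{H}$. Its frame operator is $x\mapsto\sum_{i\in\mathbb{N}}\langle x,f_i\rangle f_i$. The pair $(S,\mathbf{c})$ is frame admissible if there exists a frame $\{f_i\}_{i\in\mathbb{N}}$ for $\mathcal{H}$ with frame operator $S$ and $\|f_i\|^2=c_i$ for every $i\in\mathbb{N}$. $U_k(S)=\sup\operatorname{tr}(SP)$, over all orthogonal projections $P$ onto $k$-dimensional subspaces of $\mathcal{H}$; $U_k(\mathbf{c})=\sup_{|F|=k}\sum_{i\in F}c_i$, over subsets $F\subset\mathbb{N}$ with exactly $k$ elements. $\|S\|_e=\inf\{\|S+K\|:K\text{ compact on }\mathcal{H}\}$ is the essential norm. *)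

(* Defs.v *)
From HB Require Import structures.
From mathcomp Require Import all_boot all_order all_algebra finmap complex.
From mathcomp Require Import all_classical all_reals all_analysis.

Set Implicit Arguments.
Unset Strict Implicit.
Unset Printing Implicit Defensive.

Import Order.TTheory GRing.Theory Num.Theory numFieldNormedType.Exports.

Local Open Scope classical_set_scope.
Local Open Scope complex_scope.
Local Open Scope ring_scope.

(* The norm of a vector, or the modulus of a complex number, as an element of
   R: the norms of normed modules over R[i] take their values in R[i]. *)
Definition rnorm (R : realType) (V : normedZmodType R[i]) (x : V) : R :=
  complex.Re `|x|.

Section Space.
Context {R : realType} (H : completeNormedModType R[i]).

Definition separable := exists D : set H, countable D /\ dense D.

Definition lin_span n (v : 'I_n -> H) : set H :=
  [set x | exists a : 'I_n -> R[i], x = \sum_(i < n) a i *: v i].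

Definition lin_indep n (v : 'I_n -> H) :=
  forall a : 'I_n -> R[i], \sum_(i < n) a i *: v i = 0 -> forall i, a i = 0.

Definition infinite_dimensional :=
  forall n (v : 'I_n -> H), lin_span v <> setT.

End Space.

Section Operators.
Context {R : realType} {H : completeNormedModType R[i]}.
Implicit Types (S K T : {linear H -> H}).

Definition bounded_op (T : H -> H) :=
  exists M : R, forall x, rnorm (T x) <= M * rnorm x.

Definition invertible_op S :=
  exists T, [/\ bounded_op T, cancel S T & cancel T S].

Definition op_norm (T : H -> H) : R :=
  sup [set rnorm (T x) | x in [set x : H | rnorm x <= 1]].

Definition compact_op (T : H -> H) :=
  compact (closure (T @` [set x : H | rnorm x <= 1])).

Definition ess_norm (S : H -> H) : R :=
  inf [set op_norm (S \+ K) | K in [set K : {linear H -> H} | compact_op K]].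

End Operators.

Section Hilbert.
Context {R : realType} {H : completeNormedModType R[i]}.

(* A form on H, linear in the first argument, making H a Hilbert space: H is
   complete and its norm is the one induced by the inner product. *)
Definition hilbert_product (ip : {dot H for Num.conj}) :=
  forall x, `|x| ^+ 2 = ip x x.

Variable ip : {dot H for Num.conj}.

Definition positive_op (T : H -> H) := forall x, 0 <= ip (T x) x.

Definition orth_proj (P : H -> H) :=
  (forall x, P (P x) = P x) /\ (forall x y, ip (P x) y = ip x (P y)).

Definition range_dim (P : H -> H) (k : nat) :=
  exists2 v : 'I_k -> H, lin_indep v & range P = lin_span v.

Definition orthonormal_basis (e : nat -> H) :=
  (forall i j, ip (e i) (e j) = (i == j)%:R) /\
  (forall x, series (fun i => ip x (e i) *: e i) @ \oo --> x).

(* T has the (finite) trace t, computed in any orthonormal basis. Orthonormal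
   bases of a separable infinite-dimensional space are indexed by nat. *)
Definition has_trace (T : H -> H) (t : R[i]) :=
  forall e, orthonormal_basis e ->
    series (fun i => ip (T (e i)) (e i) : R[i]^o) @ \oo --> (t : R[i]^o).

(* tr T = +oo, for a positive operator T. *)
Definition infinite_trace (T : H -> H) :=
  forall e, orthonormal_basis e ->
    (\sum_(i <oo) (complex.Re (ip (T (e i)) (e i)))%:E = +oo)%E.

(* U_k(S). The trace of S P is that of P S P, hence real for self-adjoint S. *)
Definition U_op (S : H -> H) (k : nat) : \bar R :=
  ereal_sup [set t%:E | t in [set t : R | exists P : {linear H -> H},
    [/\ orth_proj P, range_dim P k & has_trace (S \o P) t%:C]]].

(* E is the projection-valued measure on the Borel sets of the line with
   S = \int t dE(t), in the weak sense: <S x, x> = \int t d<E(t) x, x> for all x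
   (which determines S by polarization). The support condition makes these
   integrals finite, so that [fine] loses nothing. *)
Record spectral_measure (S : H -> H)
    (E : set (measurableTypeR R) -> {linear H -> H}) : Prop := SpectralMeasure {
  spectral_proj : forall A, measurable A -> orth_proj (E A) ;
  spectral_total : forall x, E setT x = x ;
  spectral_sigma_additive : forall F : nat -> set (measurableTypeR R),
    (forall i, measurable (F i)) -> trivIset setT F ->
    forall x, series (fun i => E (F i) x) @ \oo --> E (\bigcup_i F i) x ;
  spectral_bounded_support :
    exists M : R, forall x, E `[- M, M]%classic x = x ;
  spectral_integral : forall x, ip (S x) x =
    (fine (\int[fun A => (complex.Re (ip (E A x) x))%:E]_t t%:E))%:C }.

Definition is_frame (f : nat -> H) :=
  exists A B : R, [/\ 0 < A, 0 < B & forall x,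
    ((A * rnorm x ^+ 2)%:E <= \sum_(i <oo) (rnorm (ip x (f i)) ^+ 2)%:E
       <= (B * rnorm x ^+ 2)%:E)%E].

Definition frame_operator (f : nat -> H) (S : H -> H) :=
  forall x, series (fun i => ip x (f i) *: f i) @ \oo --> S x.

Definition frame_admissible (S : H -> H) (c : nat -> R) :=
  exists f : nat -> H,
    [/\ is_frame f, frame_operator f S & forall i, rnorm (f i) ^+ 2 = c i].

End Hilbert.

Definition U_seq {R : realType} (c : nat -> R) (k : nat) : \bar R :=
  ereal_sup [set (\sum_(i <- F) c i)%:E
            | F in [set F : {fset nat} | #|` F|%fset = k]].

(* Main.v *)
(** Write [g (x) g] for [x |-> <x, g> g].  The vectors are peeled off one at a
    time from [S], keeping [S - sum_(i < n) f_i (x) f_i] positive.  Two moves are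
    used.  If [T] is positive, then [T - f (x) f] with [f = T x / sqrt <T x, x>]
    is positive and kills [x].  A rotation of the pair [(h, g)] leaves
    [h (x) h + g (x) g] unchanged and gives the first vector any squared norm
    between those of [h] and [g].

    Let [limsup c < beta < s], where [s] is the essential norm, and let
    [c_i <= beta] for [i >= n].  Above [s] the form of [S] attains its maxima, so
    the trace of [P_2] provides top eigenvectors, and by Ky Fan's principle the
    hypotheses on [U_k] say that [c_0, ..., c_(n-1)] is weakly majorized by the
    top eigenvalues continued by some [t < s]; a Schur-Horn argument by rotations
    then yields [f_0, ..., f_(n-1)].  For [t < s] every finite set of vectors is
    orthogonal to a unit vector where the form of [S] exceeds [t].  Hence, for
    the next basis vector [e_k], the killing vector [h] and sufficiently many
    vectors of squared norm slightly above [beta] can be peeled off together,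
    and rotations turn them into vectors with the next prescribed norms.  As
    each [e_k] is eventually killed and the remainders are positive and bounded,
    they tend strongly to [0]. *)

Require Import Defs.
From HB Require Import structures.
From mathcomp Require Import all_boot all_order all_algebra finmap complex.
From mathcomp Require Import all_classical all_reals all_analysis.
From mathcomp Require Import measurable_realfun ring lra.

Set Implicit Arguments.
Unset Strict Implicit.
Unset Printing Implicit Defensive.

Import Order.TTheory GRing.Theory Num.Theory numFieldNormedType.Exports.

Local Open Scope classical_set_scope.
Local Open Scope complex_scope.
Local Open Scope ring_scope.

(** * Positive operators and finite sums of rank one operators *)

Section Form.
Variables (R : realType) (H : completeNormedModType R[i]).
Variable ip : {dot H for Num.conj}.
Implicit Types (x y z f g h : H) (a b : R[i]) (T : {linear H -> H}).
Implicit Types (fs gs : seq H).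

(** Three demands compete: the norms are prescribed one by one, every remainder has to stay
    positive, and the remainders have to vanish in the limit. Peeling serves the last two, but the
    squared norm of a killing vector cannot be controlled; rotations adjust norms, but conserve
    their total. So each killing vector is joined by a supply of vectors of one squared norm [t],
    chosen to make the totals agree exactly. This is an integrality condition, [L = t *+ p] with [t]
    between [beta] and [beta']; it is solvable once [L] is large, and the divergence of the sum of
    [c] makes it so. The supply never runs dry: its test vectors are orthogonal to all that was
    removed, so they see [S] itself and not the remainder. Only the first [n] norms may exceed what
    it delivers, and only there do the [U_k] enter. If [P_2] has finite trace, strictness for
    [k > r] leaves room for some [t < s], as finitely many [k] matter. Weak majorization lets this
    first batch remove less than the eigenvectors would; the excess stays in the remainder and is
    consumed later. *)

Lemma conjD a b : ((a + b)^* = a^* + b^*)%R. Proof. exact: rmorphD. Qed.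

Lemma conjM a b : ((a * b)^* = a^* * b^*)%R. Proof. exact: rmorphM. Qed.

Lemma conjN a : ((- a)^* = - a^*)%R. Proof. exact: rmorphN. Qed.

Lemma opD T x y : T (x + y) = T x + T y. Proof. exact: linearD. Qed.

Lemma opB T x y : T (x - y) = T x - T y. Proof. exact: linearB. Qed.

Lemma opZ T a x : T (a *: x) = a *: T x. Proof. exact: linearZ. Qed.

Lemma op_sum T (I : Type) (s : seq I) (F : I -> H) :
  T (\sum_(i <- s) F i) = \sum_(i <- s) T (F i).
Proof. exact: raddf_sum. Qed.

Lemma ipDl x y z : ip (x + y) z = ip x z + ip y z.
Proof. exact: linearDl. Qed.

Lemma ipDr x y z : ip z (x + y) = ip z x + ip z y.
Proof. exact: linearDr. Qed.

Lemma ipZl a x y : ip (a *: x) y = a * ip x y.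
Proof. exact: linearZl_LR. Qed.

Lemma ipZr a x y : ip x (a *: y) = a^*%R * ip x y.
Proof. exact: linearZr_LR. Qed.

Lemma ipNl x y : ip (- x) y = - ip x y.
Proof. exact: linearNl. Qed.

Lemma ipNr x y : ip x (- y) = - ip x y.
Proof. exact: linearNr. Qed.

Lemma ipBl x y z : ip (x - y) z = ip x z - ip y z.
Proof. by rewrite ipDl ipNl. Qed.

Lemma ipBr x y z : ip z (x - y) = ip z x - ip z y.
Proof. by rewrite ipDr ipNr. Qed.

Lemma ip0l x : ip 0 x = 0.
Proof. exact: linear0l. Qed.

Lemma ip0r x : ip x 0 = 0.
Proof. exact: linear0r. Qed.

Lemma ip_suml (I : Type) (s : seq I) (P : pred I) (F : I -> H) x :
  ip (\sum_(i <- s | P i) F i) x = \sum_(i <- s | P i) ip (F i) x.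
Proof. exact: linear_sumlz. Qed.

Lemma ip_sumr (I : Type) (s : seq I) (P : pred I) (F : I -> H) x :
  ip x (\sum_(i <- s | P i) F i) = \sum_(i <- s | P i) ip x (F i).
Proof. exact: raddf_sum. Qed.

Lemma ipC x y : ip y x = (ip x y)^*%R.
Proof. by rewrite hermC /= expr0 mul1r. Qed.

Lemma ip_ge0 x : 0 <= ip x x. Proof. exact: dnorm_ge0. Qed.

Lemma ip_eq0 x : (ip x x == 0) = (x == 0). Proof. exact: dnorm_eq0. Qed.

Lemma ipMC x y : ip x y * ip y x = `|ip x y| ^+ 2.
Proof. by rewrite normCK [ip y x]ipC. Qed.

Lemma ip_eq0C x y : ip x y = 0 -> ip y x = 0.
Proof. by move=> xy0; rewrite ipC xy0 rmorph0. Qed.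

(** Polarization: expanding the real values of the form at [x + y] and at [x + i y] gives two
    relations whose sum is twice the claim. Complex scalars are essential here. *)
Lemma positive_self_adjoint T x y :
  positive_op ip T -> ip (T x) y = ip x (T y).
Proof.
move=> Tpos.
have Treal z : (ip (T z) z)^*%R = ip (T z) z.
  by apply: conj_Creal; apply: ger0_real; exact: Tpos.
rewrite [RHS]ipC.
have h1 : ip (T x) y + ip (T y) x =
          (ip (T x) y)^*%R + (ip (T y) x)^*%R.
  have := Treal (x + y); rewrite !opD !ipDl !ipDr !conjD !Treal => e.
  have /eqP := e; rewrite eq_sym -subr_eq0 => /eqP e'.
  by apply/eqP; rewrite -subr_eq0; apply/eqP; rewrite -[RHS]e'; ring.
have h2 : ip (T x) y - ip (T y) x =
          (ip (T y) x)^*%R - (ip (T x) y)^*%R.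
  have := Treal (x + 'i%C *: y).
  have ci : ('i%C : R[i])^*%R = - 'i%C by apply/eqP; rewrite eq_complex /= oppr0 !eqxx.
  rewrite !opD !opZ !ipDl !ipDr !ipZl !ipZr !conjD !conjM ci !conjN !ci !Treal.
  rewrite ?ci !opprK => e.
  have i0 : ('i%C : R[i]) != 0 by rewrite eq_complex /= eqxx oner_eq0.
  apply: (mulfI i0); apply/eqP; rewrite -subr_eq0; apply/eqP.
  have /eqP := e; rewrite -subr_eq0 => /eqP e'.
  by rewrite -[RHS]e'; ring.
have : ip (T x) y *+ 2 = (ip (T y) x)^*%R *+ 2.
  rewrite !mulr2n; have -> : ip (T x) y + ip (T x) y =
    (ip (T x) y + ip (T y) x) + (ip (T x) y - ip (T y) x) by ring.
  by rewrite h1 h2; ring.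
by move/eqP; rewrite eqrMn2r //= => /eqP.
Qed.

(** With the values named [a], [b], [d] in the proof, the form at [d x - b y] is [d (a d - |b|^2)].
    For [d = 0] a symmetric choice works when [a] is nonzero; when both vanish, [x - b y] gives
    [- 2 |b|^2 >= 0]. *)
Lemma positive_CauchySchwarz T x y : positive_op ip T ->
  `|ip (T x) y| ^+ 2 <= ip (T x) x * ip (T y) y.
Proof.
move=> Tpos; set a := ip (T x) x; set b := ip (T x) y; set d := ip (T y) y.
have a0 : 0 <= a := Tpos x. have d0 : 0 <= d := Tpos y.
have ar : a^*%R = a by apply: conj_Creal; apply: ger0_real.
have dr : d^*%R = d by apply: conj_Creal; apply: ger0_real.
have key (z w : R[i]) : 0 <= z * z^*%R * a + z * w^*%R * b + w * z^*%R * b^*%R + w * w^*%R * d.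
  have := Tpos (z *: x + w *: y).
  rewrite opD !opZ ipDl !ipDr !ipZl !ipZr -/a -/b -/d.
  rewrite (positive_self_adjoint _ _ Tpos) [ip y (T x)]ipC -/b.
  by congr (0 <= _); ring.
have [d0'|] := eqVneq d 0; last first.
  move=> dn0; have dp : 0 < d by rewrite lt_def dn0.
  have := key d (- b); rewrite conjN dr.
  have -> : d * d * a + d * - b^*%R * b + - b * d * b^*%R + - b * - b^*%R * d
     = d * (a * d - b * b^*%R) by ring.
  by rewrite pmulr_rge0 // subr_ge0 normCK.
have [a0'|] := eqVneq a 0; last first.
  move=> an0; have ap : 0 < a by rewrite lt_def an0.
  have := key (- b^*%R) a; rewrite conjN conjCK ar.
  have -> : - b^*%R * - b * a + - b^*%R * a * b + a * - b * b^*%R + a * a * d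
     = a * (a * d - b * b^*%R) by ring.
  by rewrite pmulr_rge0 // subr_ge0 normCK.
have := key 1 (- b); rewrite a0' d0' conjN conjC1 normCK.
have -> : 1 * 1 * 0 + 1 * - b^*%R * b + - b * 1 * b^*%R + - b * - b^*%R * 0
   = - (b * b^*%R *+ 2) by ring.
by rewrite oppr_ge0 pmulrn_lle0 // mulr0.
Qed.

Lemma CauchySchwarz_ip x y : `|ip x y| ^+ 2 <= ip x x * ip y y.
Proof.
pose I : {linear H -> H} := idfun.
have Ipos : positive_op ip I by move=> z; exact: ip_ge0.
exact: (positive_CauchySchwarz x y Ipos).
Qed.

(** Cauchy-Schwarz for the form of [T] at [x] and [T x]. It explains why a killed vector stays
    killed: later positive remainders have a smaller form, which is still zero at that vector. *)
Lemma positive_ip_eq0 T x : positive_op ip T -> ip (T x) x = 0 -> T x = 0.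
Proof.
move=> Tpos Tx0; apply/eqP; rewrite -ip_eq0 -normr_eq0 -sqrf_eq0 eq_le.
by rewrite exprn_ge0 // andbT (le_trans (positive_CauchySchwarz _ _ Tpos)) // Tx0 mul0r.
Qed.

Definition rank1_sum fs x : H := \sum_(f <- fs) ip x f *: f.

Lemma rank1_sum_is_linear fs : linear (rank1_sum fs).
Proof.
move=> a x y; rewrite /rank1_sum scaler_sumr -big_split /=.
by apply: eq_bigr => f _; rewrite ipDl ipZl scalerDl scalerA.
Qed.

HB.instance Definition _ fs :=
  GRing.isLinear.Build _ _ _ _ (rank1_sum fs) (@rank1_sum_is_linear fs).

Definition deflate T fs x : H := T x - rank1_sum fs x.

Lemma deflate_is_linear T fs : linear (deflate T fs).
Proof.
move=> a x y; rewrite /deflate (linearP T) rank1_sum_is_linear scalerBr opprD.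
by rewrite addrACA.
Qed.

HB.instance Definition _ T fs :=
  GRing.isLinear.Build _ _ _ _ (deflate T fs) (@deflate_is_linear T fs).

Lemma rank1_sum_ip fs x y :
  ip (rank1_sum fs x) y = \sum_(f <- fs) ip x f * ip f y.
Proof. by rewrite ip_suml; apply: eq_bigr => f _; rewrite ipZl. Qed.

Lemma rank1_sum_quad fs x :
  ip (rank1_sum fs x) x = \sum_(f <- fs) `|ip x f| ^+ 2.
Proof. by rewrite rank1_sum_ip; apply: eq_bigr => f _; rewrite ipMC. Qed.

Lemma rank1_sum_cat fs gs x :
  rank1_sum (fs ++ gs) x = rank1_sum fs x + rank1_sum gs x.
Proof. by rewrite /rank1_sum big_cat. Qed.

Lemma rank1_sum_cons f gs x :
  rank1_sum (f :: gs) x = ip x f *: f + rank1_sum gs x.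
Proof. by rewrite /rank1_sum big_cons. Qed.

Lemma rank1_sum_orth fs x :
  (forall f, f \in fs -> ip x f = 0) -> rank1_sum fs x = 0.
Proof.
by move=> x0; rewrite /rank1_sum big_seq big1 // => f /x0 ->; rewrite scale0r.
Qed.

Lemma deflate_quad T fs x :
  ip (deflate T fs x) x = ip (T x) x - \sum_(f <- fs) `|ip x f| ^+ 2.
Proof. by rewrite /deflate ipBl rank1_sum_quad. Qed.

Lemma deflate_cons T f fs x :
  deflate T (f :: fs) x = deflate (deflate T fs) [:: f] x.
Proof.
rewrite /deflate /= /deflate rank1_sum_cons /rank1_sum big_seq1 opprD.
by rewrite [- (ip x f *: f) - _]addrC addrA.
Qed.

Lemma deflate_cat T fs gs x :
  deflate T (fs ++ gs) x = deflate (deflate T fs) gs x.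
Proof. by rewrite /deflate /= /deflate rank1_sum_cat opprD addrA. Qed.

(** Subtracting more lowers the form. Positivity therefore needs checking at the ends of batches
    only. *)
Lemma positive_deflate_catl T fs gs :
  positive_op ip (deflate T (fs ++ gs)) -> positive_op ip (deflate T fs).
Proof.
move=> + x => /(_ x); rewrite deflate_cat deflate_quad subr_ge0 => /(le_trans _); apply.
by apply: sumr_ge0 => f _; rewrite exprn_ge0.
Qed.

End Form.

(** * Peeling and rotating rank one operators *)

Section Rank1.
Variables (R : realType) (H : completeNormedModType R[i]).
Variable ip : {dot H for Num.conj}.
Implicit Types (x y z f g h : H) (a b : R[i]) (T : {linear H -> H}).
Implicit Types (fs gs : seq H) (r t c : R) (cs : seq R).

Definition nsq x : R := complex.Re (ip x x).

Lemma ReK a : 0 <= a -> (complex.Re a)%:C = a.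
Proof. by move=> a0; apply: RRe_real; apply: ger0_real. Qed.

Lemma ipxx x : ip x x = (nsq x)%:C.
Proof. by rewrite ReK // ip_ge0. Qed.

Lemma nsq_ge0 x : 0 <= nsq x.
Proof. by rewrite -ler0c -ipxx ip_ge0. Qed.

Lemma nsq_eq0 x : (nsq x == 0) = (x == 0).
Proof. by rewrite -(ip_eq0 ip) ipxx -(inj_eq (@complexI R)). Qed.

Lemma nsq0 : nsq 0 = 0.
Proof. by apply/eqP; rewrite nsq_eq0. Qed.

Lemma conj_real r : ((r%:C : R[i])^*)%R = r%:C.
Proof. exact: conjc_real. Qed.

Lemma nsqZr r x : nsq (r%:C *: x) = r ^+ 2 * nsq x.
Proof.
by apply: (@complexI R); rewrite -ipxx ipZl ipZr conj_real ipxx mulrA -expr2 !rmorphM.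
Qed.

(* [sqrt r *: T x] is the multiple of [T x] with the largest rank one
   operator below [T] when [r <T x, x> = 1]. *)
Lemma positive_deflate_scale T x r : positive_op ip T -> 0 <= r ->
  r%:C * ip (T x) x <= 1 ->
  positive_op ip (deflate ip T [:: (Num.sqrt r)%:C *: T x]).
Proof.
move=> Tpos r0 le1 y; rewrite deflate_quad big_seq1 ipZr conj_real normrM exprMn.
rewrite -(positive_self_adjoint y x Tpos) [X in X ^+ 2 * _]ger0_norm ?ler0c ?sqrtr_ge0 //.
rewrite -rmorphXn /= sqr_sqrtr // subr_ge0.
have := positive_CauchySchwarz y x Tpos.
move=> /(@ler_wpM2l _ r%:C _) => /(_ _)/le_trans-> //; first by rewrite ler0c.
by rewrite mulrCA ler_piMr.
Qed.

Lemma deflate_kill T x r : positive_op ip T -> 0 <= r ->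
  r%:C * ip (T x) x = 1 -> deflate ip T [:: (Num.sqrt r)%:C *: T x] x = 0.
Proof.
move=> Tpos r0 e1; rewrite /deflate /rank1_sum big_seq1 ipZr conj_real scalerA.
rewrite mulrAC -rmorphM /= -expr2 sqr_sqrtr //.
by rewrite -(positive_self_adjoint x x Tpos) e1 scale1r subrr.
Qed.

Lemma positive_deflate_kill T x : positive_op ip T ->
  exists f, positive_op ip (deflate ip T [:: f]) /\ deflate ip T [:: f] x = 0.
Proof.
move=> Tpos; have [Tx0|Tx0] := eqVneq (ip (T x) x) 0.
  have T0 y : deflate ip T [:: 0] y = T y.
    by rewrite /deflate /rank1_sum big_seq1 scaler0 subr0.
  exists 0; split; first by move=> y; rewrite T0.
  by rewrite T0 (positive_ip_eq0 Tpos).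
set r := (complex.Re (ip (T x) x))^-1.
have rE : r%:C * ip (T x) x = 1.
  rewrite -[X in _ * X](ReK (Tpos x)) -rmorphM /= mulVf ?rmorph1 //.
  by apply: contra_neq Tx0 => e; rewrite -(ReK (Tpos x)) e.
have r0 : 0 <= r by rewrite invr_ge0 -ler0c (ReK (Tpos x)).
exists ((Num.sqrt r)%:C *: T x); split; last exact: deflate_kill.
by apply: positive_deflate_scale => //; rewrite rE.
Qed.

(** A capacity that no finite list exhausts. Orthogonality to [fs] makes [T] and [deflate ip T fs]
    agree at [x], so the bound survives any finite peeling. *)
Definition spacious T t := forall fs, exists x,
  [/\ ip x x = 1, forall f, f \in fs -> ip x f = 0 & t%:C <= ip (T x) x].

(** The vector removed is the multiple of [T x] with squared norm [t]. It fits below the remainder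
    because [t <T x, x> <= <T x, x>^2 <= |T x|^2] for the unit vector [x]. *)
Lemma spacious_deflate T t fs : spacious T t -> 0 <= t ->
  positive_op ip (deflate ip T fs) ->
  exists2 g, nsq g = t & positive_op ip (deflate ip T (g :: fs)).
Proof.
move=> /(_ fs)[x [x1 xfs tx]] t0 Tpos.
have TxE : deflate ip T fs x = T x by rewrite /deflate rank1_sum_orth // subr0.
have cs : `|ip (T x) x| ^+ 2 <= ip (T x) (T x).
  by rewrite -[leRHS]mulr1 -x1; exact: CauchySchwarz_ip.
have Tx0 : 0 <= ip (T x) x by rewrite -TxE; exact: Tpos.
pose g := (Num.sqrt (t / nsq (T x)))%:C *: T x.
have r0 : 0 <= t / nsq (T x) by rewrite divr_ge0 // nsq_ge0.
have cs' : t * complex.Re (ip (T x) x) <= nsq (T x).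
  rewrite -lecR -ipxx (le_trans _ cs) // ger0_norm // rmorphM /= ReK // expr2.
  by rewrite ler_wpM2r.
have [Tx00|Txn0] := eqVneq (nsq (T x)) 0.
  have t00 : t = 0.
    apply/eqP; rewrite eq_le t0 andbT -lecR (le_trans tx) //.
    by move/eqP: Tx00; rewrite nsq_eq0 => /eqP ->; rewrite ip0l.
  exists 0; first by rewrite nsq0.
  move=> y; rewrite deflate_quad big_cons ip0r normr0 expr0n add0r -deflate_quad.
  exact: Tpos.
exists g; first by rewrite nsqZr sqr_sqrtr // divfK.
move=> y; rewrite deflate_cons /g -TxE; apply: positive_deflate_scale => //; rewrite TxE //.
rewrite /= TxE -(ReK Tx0) -rmorphM -[1]/(1%:C) lecR mulrAC ler_pdivrMr ?mul1r //.
by rewrite lt_def Txn0 nsq_ge0.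
Qed.

(** The ratio [t = b / a] solves [(q - c) t^2 + 2 m t + (p - c) = 0], whose discriminant is
    nonnegative because [p <= c <= q]; [u] then normalizes. For [c = q] the equation degenerates,
    and the pair is merely swapped. *)
Lemma rotation_angle (p q c m : R) : p <= c <= q ->
  exists a b : R, a ^+ 2 + b ^+ 2 = 1 /\
    a ^+ 2 * p + b ^+ 2 * q + 2 * a * b * m = c.
Proof.
move=> /andP[pc cq]; have [<-|qc] := eqVneq c q.
  by exists 0, 1; split; ring.
have qc0 : 0 < q - c by rewrite subr_gt0 lt_def eq_sym qc.
pose D := m ^+ 2 - (q - c) * (p - c).
have D0 : 0 <= D by rewrite subr_ge0 (le_trans _ (sqr_ge0 m)) // pmulr_rle0 // subr_le0.
pose t := (Num.sqrt D - m) / (q - c).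
have tE : (q - c) * t ^+ 2 + 2 * m * t + (p - c) = 0.
  have : (q - c) * t = Num.sqrt D - m by rewrite /t mulrC divfK ?gt_eqF.
  move=> e; apply: (mulfI (lt0r_neq0 qc0)); rewrite mulr0.
  have -> : (q - c) * ((q - c) * t ^+ 2 + 2 * m * t + (p - c)) =
    ((q - c) * t) ^+ 2 + 2 * m * ((q - c) * t) + (q - c) * (p - c) by ring.
  rewrite e; have -> : (Num.sqrt D - m) ^+ 2 + 2 * m * (Num.sqrt D - m) + (q - c) * (p - c)
   = Num.sqrt D ^+ 2 - D by rewrite /D; ring.
  by rewrite sqr_sqrtr // subrr.
have u0 : 0 < 1 + t ^+ 2 by rewrite ltr_pwDl // sqr_ge0.
pose u := Num.sqrt (1 + t ^+ 2)^-1.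
have uE : u ^+ 2 * (1 + t ^+ 2) = 1.
  by rewrite sqr_sqrtr ?invr_ge0 ?ltW // mulVf // gt_eqF.
exists u, (u * t); split; first by rewrite -[RHS]uE; ring.
have -> : u ^+ 2 * p + (u * t) ^+ 2 * q + 2 * u * (u * t) * m
  = u ^+ 2 * ((q - c) * t ^+ 2 + 2 * m * t + (p - c)) + u ^+ 2 * (1 + t ^+ 2) * c by ring.
by rewrite tE uE mulr0 add0r mul1r.
Qed.

Lemma nsq_comb (r t : R) x y : nsq (r%:C *: x + t%:C *: y) =
  r ^+ 2 * nsq x + t ^+ 2 * nsq y + 2 * r * t * complex.Re (ip x y).
Proof.
apply: (@complexI R); rewrite -ipxx !rmorphD !rmorphM /= !ipDl !ipDr !ipZl !ipZr.
rewrite !conj_real !ipxx.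
have -> : (complex.Re (ip x y))%:C = (ip x y + ip y x) / 2.
  by rewrite ReJ_add [ip y x]ipC.
rewrite rmorph_nat.
have two : (2 : R[i]) != 0 by rewrite pnatr_eq0.
by field.
Qed.

Lemma rotation h g c : nsq h <= c <= nsq g ->
  exists f k, [/\ nsq f = c, nsq k = nsq h + nsq g - c
    & forall x, rank1_sum ip [:: f; k] x = rank1_sum ip [:: h; g] x].
Proof.
move=> /(rotation_angle (complex.Re (ip h g)))[a [b [ab1 abc]]].
exists (a%:C *: h + b%:C *: g), ((- b)%:C *: h + a%:C *: g); split.
- by rewrite nsq_comb.
- rewrite nsq_comb -[in RHS]abc.
  have -> : nsq h + nsq g = (a ^+ 2 + b ^+ 2) * (nsq h + nsq g) by rewrite ab1 mul1r.
  ring.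
move=> x; rewrite !rank1_sum_cons !ipDr !ipZr !conj_real.
set u := ip x h; set v := ip x g; set o := rank1_sum _ _ _.
rewrite !addrA; congr (_ + o); rewrite !rmorphN /=.
have e1 : u = (a%:C * u + b%:C * v) * a%:C + (- b%:C * u + a%:C * v) * - b%:C.
  have : (a%:C * a%:C + b%:C * b%:C = 1 :> R[i]) by rewrite -!rmorphM -rmorphD /= -!expr2 ab1.
  by move=> e; rewrite -[LHS]mul1r -e; ring.
have e2 : v = (a%:C * u + b%:C * v) * b%:C + (- b%:C * u + a%:C * v) * a%:C.
  have : (a%:C * a%:C + b%:C * b%:C = 1 :> R[i]) by rewrite -!rmorphM -rmorphD /= -!expr2 ab1.
  by move=> e; rewrite -[LHS]mul1r -e; ring.
by rewrite !scalerDr !scalerA addrACA -!scalerDl -e1 -e2.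
Qed.

Lemma rank1_sum_eq0 gs : \sum_(g <- gs) nsq g = 0 -> forall x, rank1_sum ip gs x = 0.
Proof.
elim: gs => [_ x|g gs IH /eqP]; first by rewrite /rank1_sum big_nil.
rewrite big_cons paddr_eq0 ?nsq_ge0 ?sumr_ge0 // => [|? _]; last exact: nsq_ge0.
by rewrite nsq_eq0 => /andP[/eqP-> /eqP gs0] x; rewrite rank1_sum_cons scaler0 add0r IH.
Qed.

(** The vector [h] is a reservoir of arbitrary norm. A prescribed [c] not above its squared norm is
    split off as a multiple of [h]; a larger one comes from rotating [h] with the next [g], and the
    second vector of the pair is the new reservoir. *)
Lemma redistribute cs gs h : (forall c, c \in cs -> 0 <= c) ->
  (forall g c, g \in gs -> c \in cs -> c <= nsq g) ->
  nsq h + \sum_(g <- gs) nsq g = \sum_(c <- cs) c ->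
  exists2 fs, map nsq fs = cs & forall x, rank1_sum ip fs x = rank1_sum ip (h :: gs) x.
Proof.
elim: cs gs h => [|c cs IH] gs h c0 cg hg.
  exists [::] => // x; rewrite [RHS](@rank1_sum_eq0 (h :: gs)) ?big_cons ?hg ?big_nil //.
  by rewrite /rank1_sum big_nil.
have cc0 : 0 <= c by rewrite c0 // mem_head.
have cs0 d : d \in cs -> 0 <= d by move=> dcs; rewrite c0 // inE dcs orbT.
have [hc|hc] := leP c (nsq h).
  (* The operator [h (x) h] is divided in the proportions [c / nsq h] and [1 - c / nsq h]. If
     [nsq h = 0] then [c = 0], and the quotient by zero is 0, as wanted. *)
  have [|//|fs fsE fsS] := IH gs ((Num.sqrt (1 - c / nsq h))%:C *: h) cs0.
  - by move=> g d gg dd; rewrite cg // inE dd orbT.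
  - have [h0|hn0] := eqVneq (nsq h) 0.
      have c00 : c = 0 by apply/eqP; rewrite eq_le cc0 andbT -h0.
      by move: hg; rewrite big_cons nsqZr h0 mulr0 c00 !add0r.
    have hp : 0 < nsq h by rewrite lt_def hn0 nsq_ge0.
    rewrite nsqZr sqr_sqrtr ?subr_ge0 ?ler_pdivrMr ?mul1r // mulrBl mul1r divfK //.
    by rewrite addrAC hg big_cons addrAC subrr add0r.
  have le1 : c / nsq h <= 1.
    have [h0|hn0] := eqVneq (nsq h) 0; first by rewrite h0 invr0 mulr0.
    by rewrite ler_pdivrMr ?mul1r // lt_def hn0 nsq_ge0.
  have ge0 : 0 <= c / nsq h by rewrite divr_ge0 // nsq_ge0.
  exists ((Num.sqrt (c / nsq h))%:C *: h :: fs) => /= [|x].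
    rewrite fsE nsqZr sqr_sqrtr //; congr (_ :: _).
    have [h0|hn0] := eqVneq (nsq h) 0; last by rewrite divfK.
    by rewrite h0 mulr0; apply/eqP; rewrite eq_le cc0 -h0.
  rewrite !rank1_sum_cons fsS !rank1_sum_cons !ipZr !conj_real !scalerA addrA -scalerDl.
  congr (_ *: _ + _); rewrite mulrAC [X in _ + X]mulrAC -!rmorphM /= -!expr2 !sqr_sqrtr ?subr_ge0 //.
  by rewrite -mulrDl -rmorphD /= addrC subrK mul1r.
(* The supply cannot be empty here: the balance would make [nsq h] the sum of [c] and nonnegative
   terms, against [nsq h < c]. *)
case: gs cg hg => [|g gs] cg.
  rewrite big_nil addr0 big_cons => hE; move: hc; rewrite hE gtrDl.
  by rewrite ltNge big_seq sumr_ge0 // => d /cs0.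
move=> hg.
have gc : c <= nsq g by rewrite cg ?mem_head.
have [f [k [fc kE fkS]]] := @rotation h g c (introT andP (conj (ltW hc) gc)).
have [|//|fs fsE fsS] := IH gs k cs0.
- by move=> g' d gg dd; rewrite cg // inE ?gg ?dd orbT.
- by move: hg; rewrite !big_cons kE; lra.
exists (f :: fs); first by rewrite /= fc fsE.
move=> x; rewrite rank1_sum_cons fsS rank1_sum_cons addrA.
have := fkS x; rewrite !rank1_sum_cons /rank1_sum big_nil !addr0 => ->.
by rewrite addrA.
Qed.

(** Finds the neighbours [k] and head of [m] between whose squared norms [c] falls: the pair to
    rotate in [schur_horn]. Choosing neighbours keeps the list sorted after the rotation. *)
Lemma split_threshold c h hs : c <= nsq h ->
  exists l k m, [/\ h :: hs = l ++ k :: m, all (fun g => c <= nsq g) (rcons l k)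
    & forall g m', m = g :: m' -> nsq g < c].
Proof.
elim: hs h => [|g hs IH] h ch; first by exists [::], h, [::]; rewrite /= ch.
have [gc|cg] := ltP (nsq g) c.
  by exists [::], h, (g :: hs); rewrite /= ch; split=> // ? ? [<-].
have [l [k [m [-> lc mc]]]] := IH g cg.
by exists (h :: l), k, m; rewrite /= ch.
Qed.

Lemma sum_take_le cs c k : 0 <= c -> all (fun d => d <= c) cs ->
  \sum_(d <- take k cs) d <= c *+ k.
Proof.
move=> c0; elim: cs k => [|d cs IH] [|k] /=; rewrite ?big_nil ?mulrn_wge0 //.
by move=> /andP[dc /IH dcs]; rewrite big_cons mulrS lerD.
Qed.

Lemma sum_take_ge cs c k : (k <= size cs)%N -> all (fun d => c <= d) cs ->
  c *+ k <= \sum_(d <- take k cs) d.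
Proof.
elim: cs k => [|d cs IH] [|k] //=; rewrite ?big_nil // ltnS => ks.
by move=> /andP[dc /(IH _ ks) dcs]; rewrite big_cons mulrS lerD.
Qed.

Lemma shrink c h : 0 <= c -> c <= nsq h -> exists2 f, nsq f = c
  & forall x, ip (ip x f *: f) x <= ip (ip x h *: h) x.
Proof.
move=> c0 ch; have [h0|hn0] := eqVneq (nsq h) 0.
  exists 0; last by move=> x; rewrite scaler0 ip0l ipZl ipMC exprn_ge0.
  by rewrite nsq0; apply/eqP; rewrite eq_le c0 -h0.
have hp : 0 < nsq h by rewrite lt_def hn0 nsq_ge0.
have r0 : 0 <= c / nsq h by rewrite divr_ge0 // nsq_ge0.
exists ((Num.sqrt (c / nsq h))%:C *: h); first by rewrite nsqZr sqr_sqrtr // divfK.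
move=> x; set s := (_)%:C.
have -> : ip x (s *: h) *: (s *: h) = (c / nsq h)%:C *: (ip x h *: h).
  rewrite ipZr conj_real !scalerA mulrAC -rmorphM /= -expr2 sqr_sqrtr //.
rewrite ipZl ler_piMl ?ipZl ?ipMC ?exprn_ge0 // -[1]/(1%:C) lecR.
by rewrite ler_pdivrMr // mul1r.
Qed.

Local Notation ger := (fun r t : R => t <= r).

(** The largest [c] is produced first, by rotating two neighbours with [nsq g < c <= nsq k]; the
    other vector [k'] takes their place and the induction continues. If all norms are at least [c],
    the last vector is shrunk instead, which is why the forms are only compared by an inequality: no
    equality of totals is assumed. *)
Lemma schur_horn cs hs : size cs = size hs -> (forall c, c \in cs -> 0 <= c) ->
  sorted ger cs -> sorted ger (map nsq hs) ->
  (forall k, (k <= size cs)%N ->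
    \sum_(c <- take k cs) c <= \sum_(r <- take k (map nsq hs)) r) ->
  exists2 fs, map nsq fs = cs
    & forall x, ip (rank1_sum ip fs x) x <= ip (rank1_sum ip hs x) x.
Proof.
elim: cs hs => [|c cs IH] [|h hs] // => [_ _ _ _ _|shs c0 scs snhs chs].
  by exists [::] => // x; rewrite /rank1_sum big_nil ip0l.
have cc0 : 0 <= c by rewrite c0 // mem_head.
have trans : transitive ger by move=> a b d ab bd; exact: le_trans bd ab.
have csc : all (fun d => d <= c) cs := order_path_min trans scs.
have ch : c <= nsq h by have := chs 1%N isT; rewrite /= !take0 !big_cons !big_nil !addr0.
have [l [k [m [hsE lk mc]]]] := split_threshold hs ch.
have step f gs : nsq f = c -> size cs = size gs -> sorted ger (map nsq gs) ->
    (forall x, ip (rank1_sum ip (f :: gs) x) x <= ip (rank1_sum ip (h :: hs) x) x) ->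
    (forall k, (k <= size cs)%N ->
      \sum_(c <- take k cs) c <= \sum_(r <- take k (map nsq gs)) r) ->
    exists2 fs, map nsq fs = c :: cs
    & forall x, ip (rank1_sum ip fs x) x <= ip (rank1_sum ip (h :: hs) x) x.
  move=> fc sgs sgn fgs cgs.
  have [|fs fsE fsgs] := IH gs sgs _ (path_sorted scs) sgn cgs.
    by move=> d dcs; rewrite c0 // inE dcs orbT.
  exists (f :: fs); first by rewrite /= fc fsE.
  move=> x; rewrite (le_trans _ (fgs x)) // !rank1_sum_cons !ipDl lerD2l.
  exact: fsgs.
(* Within [l] the majorization is automatic, since [c] separates the entries of [cs] from the
   squared norms of [l]. *)
have small j : (j <= size l)%N -> \sum_(d <- take j cs) d <= \sum_(r <- take j (map nsq l)) r.
  move=> jl; apply: (le_trans (sum_take_le _ cc0 csc)).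
  apply: sum_take_ge; first by rewrite size_map.
  by move: lk; rewrite all_rcons all_map => /andP[].
have kc : c <= nsq k by move: lk; rewrite all_rcons => /andP[].
case: m => [|g m] in hsE mc.
  have [f fc fk] := shrink cc0 kc.
  have sl : size cs = size l.
    by move: shs => [->]; have := congr1 size hsE; rewrite size_cat /= addn1 => -[].
  apply: (step f l) => //; last by rewrite sl.
    by move: snhs; rewrite hsE map_cat => /cat_sorted2[].
  by move=> x; rewrite hsE rank1_sum_cat !rank1_sum_cons [rank1_sum _ [::] x]/rank1_sum
     big_nil addr0 addrC !ipDl lerD2l.
have gc : nsq g < c := mc _ _ erefl.
have [f [k' [fc k'E fk'S]]] := @rotation g k c (introT andP (conj (ltW gc) kc)).
have slm : size cs = size l + (size m).+1.
  by move: shs => [->]; have := congr1 size hsE; rewrite size_cat /= addnS => -[].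
(* The new squared norm lies between those of [g] and [k], so [l ++ k' :: m] is still
   nonincreasing. *)
have k'k : nsq k' <= nsq k by lra.
have gk' : nsq g <= nsq k' by lra.
apply: (step f (l ++ k' :: m)) => //.
- by rewrite size_cat.
- move: snhs; rewrite hsE !sorted_pairwise // !map_cat !pairwise_cat /= !allrel_consr.
  move=> /and3P[/and3P[lk1 _ lm] pl /andP[/andP[_ km] /andP[gm pm]]].
  rewrite lm pl pm !andbT /=; apply/andP; split.
    by apply/allP => d /(allP lk1) /(le_trans k'k).
  by apply/allP => d /(allP gm) dg; exact: le_trans dg gk'.
- move=> x; rewrite hsE rank1_sum_cons !rank1_sum_cat !rank1_sum_cons.
  have := fk'S x; rewrite !rank1_sum_cons [rank1_sum _ [::] x]/rank1_sum big_nil !addr0.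
  move=> e; rewrite addrCA; set u := ip x f *: f + _.
  suff -> : u = ip x k *: k + (ip x g *: g + rank1_sum ip m x) by [].
  by rewrite /u addrA e -addrA addrCA.
move=> j jcs; have [jl|lj] := leqP j (size l).
  by rewrite map_cat takel_cat ?size_map //; exact: small.
(* Past [l], the hypothesis is used for [j.+1] terms: both sides contain [c] once, on the right
   through [nsq k + nsq g = c + nsq k']. *)
have [i ji] : exists i, j = (size l + i.+1)%N.
  by exists (j - size l).-1; rewrite prednK ?subn_gt0 // subnKC // ltnW.
have {chs} := chs j.+1 jcs; rewrite [take _ (c :: cs)]/= big_cons.
have -> : take j.+1 (map nsq (h :: hs)) = map nsq l ++ nsq k :: nsq g :: take i (map nsq m).
  by rewrite hsE map_cat take_cat size_map ji -addnS ltnNge leq_addr /= addKn.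
have -> : take j (map nsq (l ++ k' :: m)) = map nsq l ++ nsq k' :: take i (map nsq m).
  by rewrite map_cat take_cat size_map ji ltnNge leq_addr /= addKn.
rewrite !big_cat /= !big_cons k'E; lra.
Qed.

End Rank1.

(** * Orthonormal sequences *)

Section Orthonormal.
Variables (R : realType) (H : completeNormedModType R[i]).
Variable ip : {dot H for Num.conj}.
Implicit Types (x y z u v : H) (a b : R[i]) (T : {linear H -> H}).
Implicit Types (us vs : seq H) (V : set H).

(** For such a list [rank1_sum ip us] is the orthogonal projection onto the span, so
    [x = rank1_sum ip us x] expresses that [x] lies in it. *)
Definition orthonormal us :=
  all (fun u => ip u u == 1) us && pairwise (fun u v => ip u v == 0) us.

Lemma orthonormal_cons u us : orthonormal (u :: us) <->
  [/\ ip u u = 1, forall v, v \in us -> ip u v = 0 & orthonormal us].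
Proof.
rewrite /orthonormal /=; split.
  move=> /andP[/andP[/eqP u1 au] /andP[/allP uu pu]].
  by split=> // [v /uu/eqP//|]; rewrite au.
case=> u1 uu /andP[au pu]; rewrite u1 eqxx au pu !andbT /=.
by apply/allP => v /uu ->.
Qed.

Lemma rank1_sum_id us x u : orthonormal us -> u \in us ->
  ip (rank1_sum ip us x) u = ip x u.
Proof.
elim: us => // v us IH /orthonormal_cons[v1 vus usus]; rewrite inE rank1_sum_cons ipDl ipZl.
move=> /orP[/eqP->|uus]; last by rewrite IH // vus // mulr0 add0r.
rewrite v1 mulr1 rank1_sum_ip big_seq big1 ?addr0 // => w wus.
by rewrite (ip_eq0C (vus _ wus)) mulr0.
Qed.

Lemma resid_orth us x u : orthonormal us -> u \in us ->
  ip (x - rank1_sum ip us x) u = 0.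
Proof. by move=> ous uus; rewrite ipBl rank1_sum_id // subrr. Qed.

Lemma resid_quad us x : orthonormal us ->
  ip (x - rank1_sum ip us x) (x - rank1_sum ip us x) =
  ip x x - ip (rank1_sum ip us x) x.
Proof.
move=> ous; rewrite ipBr [X in _ - X]ip_sumr big_seq big1 => [|u uus].
  by rewrite subr0 ipBl.
by rewrite ipZr resid_orth // mulr0.
Qed.

Lemma bessel us x : orthonormal us -> ip (rank1_sum ip us x) x <= ip x x.
Proof. by move=> ous; rewrite -subr_ge0 -resid_quad // ip_ge0. Qed.

Lemma orthonormal_extend us x : orthonormal us -> x != rank1_sum ip us x ->
  exists2 r : R, orthonormal (r%:C *: (x - rank1_sum ip us x) :: us)
    & x = rank1_sum ip (r%:C *: (x - rank1_sum ip us x) :: us) x.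
Proof.
move=> ous; rewrite -subr_eq0; set w := x - _ => w0.
have n0 : 0 < nsq ip w by rewrite lt_def nsq_ge0 nsq_eq0 w0.
pose r := Num.sqrt (nsq ip w)^-1.
have rE : r ^+ 2 * nsq ip w = 1 by rewrite sqr_sqrtr ?invr_ge0 ?ltW // mulVf // gt_eqF.
exists r.
  apply/orthonormal_cons; split=> //; first by rewrite ipxx nsqZr rE.
  by move=> v vus; rewrite ipZl resid_orth // mulr0.
rewrite rank1_sum_cons ipZr conj_real scalerA mulrAC -rmorphM -expr2 /=.
have -> : ip x w = (nsq ip w)%:C.
  rewrite -ipxx /w ipBl [X in _ = _ - X]rank1_sum_ip big_seq big1 ?subr0 // => u uus.
  by rewrite [ip u _]ipC -/w /w resid_orth // rmorph0 mulr0.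
by rewrite -rmorphM /= rE scale1r subrK.
Qed.

Lemma rank1_sum_fix_cons v us x : orthonormal (v :: us) ->
  x = rank1_sum ip us x -> x = rank1_sum ip (v :: us) x.
Proof.
move=> /orthonormal_cons[_ vus _] xE; rewrite rank1_sum_cons -xE -[LHS]add0r.
congr (_ + _); suff -> : ip x v = 0 by rewrite scale0r.
rewrite xE rank1_sum_ip big_seq big1 // => u /vus/ip_eq0C ->.
by rewrite mulr0.
Qed.

Lemma exists_orthonormal_span vs :
  exists2 us, orthonormal us & forall v, v \in vs -> v = rank1_sum ip us v.
Proof.
elim: vs => [|v vs [us ous usE]]; first by exists [::].
have [vE|] := eqVneq v (rank1_sum ip us v).
  by exists us => // u; rewrite inE => /orP[/eqP->|/usE].
move=> /(orthonormal_extend ous)[r ous' vE].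
exists (r%:C *: (v - rank1_sum ip us v) :: us) => // u; rewrite inE => /orP[/eqP->//|].
by move=> /usE; exact: rank1_sum_fix_cons.
Qed.

Definition subspace V := V 0 /\ forall a x y, V x -> V y -> V (a *: x + y).

Lemma subspaceB V x y : subspace V -> V x -> V y -> V (y - x).
Proof. by move=> [_ Vl] Vx Vy; have := Vl (-1) _ _ Vx Vy; rewrite scaleN1r addrC. Qed.

Lemma subspaceZ V a x : subspace V -> V x -> V (a *: x).
Proof. by move=> [V0 Vl] Vx; have := Vl a _ _ Vx V0; rewrite addr0. Qed.

Lemma subspace_rank1_sum V us x : subspace V -> (forall u, u \in us -> V u) ->
  V (rank1_sum ip us x).
Proof.
move=> sV; elim: us => [_|u us IH Vus].
  by rewrite /rank1_sum big_nil; exact: sV.1.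
rewrite rank1_sum_cons; apply: sV.2; first by apply: Vus; rewrite mem_head.
by apply: IH => v vus; apply: Vus; rewrite inE vus orbT.
Qed.

(** Gram-Schmidt inside [V], stopped when it has [m] vectors or finds nothing outside the span. It
    replaces any notion of dimension for [V]. *)
Lemma orthonormal_or_spanning V m : subspace V ->
  (exists us, [/\ orthonormal us, forall u, u \in us -> V u & size us = m]) \/
  (exists us, [/\ orthonormal us, forall u, u \in us -> V u, (size us < m)%N
    & forall x, V x -> x = rank1_sum ip us x]).
Proof.
move=> sV; elim: m => [|m [[us [ous Vus us_m]]|[us [? ? usm ?]]]].
- by left; exists [::].
- have [spn|] := pselect (forall x, V x -> x = rank1_sum ip us x).
    by right; exists us; split; rewrite ?us_m.
  move=> /existsNP[x /not_implyP[Vx /eqP/(orthonormal_extend ous)[r ons _]]].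
  left; exists (r%:C *: (x - rank1_sum ip us x) :: us); split=> //=; last by rewrite us_m.
  move=> u; rewrite inE => /orP[/eqP->|]; last exact: Vus.
  by apply: subspaceZ => //; apply: subspaceB => //; exact: subspace_rank1_sum.
by right; exists us; split=> //; rewrite ltnW.
Qed.

Lemma left_kernel m k (A : 'M[R[i]]_(m, k)) : (k < m)%N ->
  exists2 a : 'rV[R[i]]_m, a != 0 & a *m A = 0.
Proof.
move=> km; have /rowV0Pn[a ak a0] : kermx A != 0.
  by rewrite -mxrank_eq0 mxrank_ker -lt0n subn_gt0 (leq_ltn_trans (rank_leq_col A)).
by exists a => //; apply/eqP; rewrite -sub_kermx.
Qed.

Lemma orthonormal_coef us (a : nat -> R[i]) i : orthonormal us -> (i < size us)%N ->
  ip (\sum_(j < size us) a j *: us`_j) us`_i = a i.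
Proof.
move=> ous ius; rewrite ip_suml (bigD1 (Ordinal ius)) //= big1 ?addr0 => [|j ji].
  move: ous => /andP[/allP/(_ us`_i) h _]; rewrite ipZl (eqP (h _)) ?mulr1 //.
  exact: mem_nth.
rewrite ipZl; move: ous => /andP[_ /pairwiseP h].
have {}ji : (j : nat) != i by apply: contra_neq ji => ji; apply: val_inj.
have [lt|] := ltnP j i.
  by rewrite (eqP (h 0 j i _ _ lt)) ?mulr0 // inE.
rewrite leq_eqVlt eq_sym (negbTE ji) /= => lt.
by rewrite (ip_eq0C (eqP (h 0 i j _ _ lt))) ?mulr0 // inE.
Qed.

(** A homogeneous linear system with [size vs] equations in the [size us] coordinates of [x]. *)
Lemma exists_orthogonal us vs : orthonormal us -> (size vs < size us)%N ->
  exists x, [/\ x != 0, x = rank1_sum ip us x & forall v, v \in vs -> ip x v = 0].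
Proof.
move=> ous vu.
have [a a0 aA] := left_kernel (\matrix_(i < size us, j < size vs) ip us`_i vs`_j) vu.
pose b i := if insub i is Some j then a 0 j else 0.
have bE (j : 'I_(size us)) : b j = a 0 j by rewrite /b valK.
pose x := \sum_(j < size us) b j *: us`_j.
have xu i : (i < size us)%N -> ip x us`_i = b i by exact: orthonormal_coef.
exists x; split.
- apply: contra_neq a0 => x0; apply/rowP => i; rewrite mxE -bE -xu // x0.
  exact: ip0l.
- rewrite /rank1_sum (big_nth 0) big_mkord; apply: eq_bigr => i _.
  by rewrite xu.
move=> v /(nthP 0)[j jvs <-]; rewrite ip_suml.
have := congr1 (fun M : 'rV_(size vs) => M 0 (Ordinal jvs)) aA; rewrite !mxE => e.
by rewrite -[RHS]e; apply: eq_bigr => i _; rewrite mxE ipZl bE.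
Qed.

(** The fixed space of [P] has no [k.+1] orthonormal vectors, since these would be combinations of
    [k] vectors and hence dependent; so Gram-Schmidt stops earlier with a list that spans it. *)
Lemma range_dim_rank1_sum (P : {linear H -> H}) k : orth_proj ip P -> range_dim P k ->
  exists us, [/\ orthonormal us, (size us <= k)%N
    & forall x, P x = rank1_sum ip us x].
Proof.
move=> [PP PS] [w _ wP].
have sV : subspace [set x | P x = x].
  by split=> /= [|a x y Px Py]; rewrite ?linear0 // opD opZ Px Py.
have [[us [ous Vus usk]]|[us [ous Vus usk us1]]] := orthonormal_or_spanning k.+1 sV.
  have /all_sig[B BE] : forall i : 'I_(size us), {b : 'I_k -> R[i] | us`_i = \sum_j b j *: w j}.
    move=> i; apply: cid; have : range P us`_i by exists us`_i => //; exact/Vus/mem_nth.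
    by rewrite wP => -[b ->]; exists b.
  have kus : (k < size us)%N by rewrite usk.
  have [a a0 aB] := left_kernel (\matrix_(i, j) B i j) kus.
  pose b i := if insub i is Some j then a 0 j else 0.
  have bE (j : 'I_(size us)) : b j = a 0 j by rewrite /b valK.
  case/eqP: a0; apply/rowP => i; rewrite mxE -bE -(orthonormal_coef b ous) //.
  have -> : \sum_(j < size us) b j *: us`_j = 0; last by rewrite ip0l.
  under eq_bigr do rewrite BE scaler_sumr.
  rewrite exchange_big big1 // => j _; have := congr1 (fun M : 'rV_k => M 0 j) aB.
  rewrite !mxE => e; under eq_bigr do rewrite scalerA.
  rewrite -scaler_suml; have -> : \sum_(l < size us) b l * B l j = 0; last by rewrite scale0r.
  by rewrite -[RHS]e; apply: eq_bigr => l _; rewrite mxE bE.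
exists us; split=> // x; rewrite {1}[P x]us1 //= /rank1_sum; apply: eq_big_seq => u /Vus /= uP.
by rewrite PS uP.
Qed.

End Orthonormal.

(** * Orthonormal bases and traces *)

Section Hilbert.
Variables (R : realType) (H : completeNormedModType R[i]).
Variable ip : {dot H for Num.conj}.
Hypothesis hip : hilbert_product ip.
Implicit Types (x y z u v w : H) (a b : R[i]) (S T : {linear H -> H}).
Implicit Types (us vs : seq H) (e : nat -> H).

Lemma normE (V : normedZmodType R[i]) (x : V) : `|x| = (rnorm x)%:C.
Proof. by rewrite ReK. Qed.

Lemma rnorm_ge0 (V : normedZmodType R[i]) (x : V) : 0 <= rnorm x.
Proof. by rewrite -ler0c ReK. Qed.

Lemma nsqE x : nsq ip x = rnorm x ^+ 2.
Proof. by apply: (@complexI R); rewrite -ipxx -hip normE rmorphXn. Qed.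

Lemma rnorm_CauchySchwarz x y : rnorm (ip x y) <= rnorm x * rnorm y.
Proof.
rewrite -(@ler_pXn2r _ 2) ?nnegrE ?mulr_ge0 ?rnorm_ge0 //.
have := CauchySchwarz_ip ip x y.
by rewrite !ipxx !nsqE -rmorphM /= -exprMn normE -rmorphXn lecR.
Qed.

Lemma cvg_nsqP (I : Type) (F : set_system I) {FF : Filter F} (f : I -> H) x :
  f @ F --> x <-> forall eps : R, 0 < eps -> \forall i \near F, nsq ip (x - f i) < eps.
Proof.
split=> [/cvgrPdist_lt fx eps eps0|fx].
  have /fx : 0 < (Num.sqrt eps)%:C by rewrite ltcR sqrtr_gt0.
  apply: filterS => i; rewrite normE ltcR nsqE => h.
  by rewrite -[ltRHS]sqr_sqrtr ?ltW // ltr_pXn2r // nnegrE ?rnorm_ge0 // ltW.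
apply/cvgrPdist_lt => eps eps0.
have epsE : eps = (complex.Re eps)%:C by rewrite ReK // ltW.
have e0 : 0 < complex.Re eps by rewrite -ltcR -epsE.
have /fx : 0 < complex.Re eps ^+ 2 by rewrite exprn_gt0.
apply: filterS => i; rewrite normE epsE ltcR nsqE => h.
by move: h; rewrite ltr_pXn2r // nnegrE ?rnorm_ge0 // ltW.
Qed.

Lemma cvg_ip (I : Type) (F : set_system I) {FF : Filter F} (f : I -> H) x y :
  f @ F --> x -> (fun i => ip (f i) y : R[i]^o) @ F --> (ip x y : R[i]^o).
Proof.
move=> fx; apply/cvgrPdist_lt => eps eps0.
have epsE : eps = (complex.Re eps)%:C by rewrite ReK // ltW.
have e0 : 0 < complex.Re eps by rewrite -ltcR -epsE.
have y0 : 0 < rnorm y + 1 by rewrite ltr_wpDl // rnorm_ge0.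
move/cvgrPdist_lt : fx => /(_ (complex.Re eps / (rnorm y + 1))%:C).
rewrite ltcR divr_gt0 // => /(_ isT); apply: filterS => i.
rewrite -ipBl epsE !normE !ltcR => h.
apply: (le_lt_trans (rnorm_CauchySchwarz _ _)).
rewrite (le_lt_trans (_ : _ <= rnorm (x - f i) * (rnorm y + 1))) //.
  by rewrite ler_wpM2l ?rnorm_ge0 // lerDl.
by rewrite -ltr_pdivlMr.
Qed.

Section Basis.
Variable e : nat -> H.
Hypothesis eB : orthonormal_basis ip e.

Lemma parseval v w :
  series (fun i => ip w (e i) * ip (e i) v : R[i]^o) @ \oo --> (ip w v : R[i]^o).
Proof.
have -> : series (fun i => ip w (e i) * ip (e i) v : R[i]^o) =
          (fun n => ip (series (fun i => ip w (e i) *: e i) n) v).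
  apply/funext => n.
  by rewrite /series /= ip_suml; apply: eq_bigr => i _; rewrite ipZl.
exact: cvg_ip (eB.2 w).
Qed.

(** The trace of the finite rank operator sending [x] to the sum of the [<x, v j> w j], by Parseval
    for each pair. *)
Lemma cvg_trace_sum (J : Type) (s : seq J) (v w : J -> H) :
  series (fun i => \sum_(j <- s) ip (e i) (v j) * ip (w j) (e i) : R[i]^o) @ \oo -->
    (\sum_(j <- s) ip (w j) (v j) : R[i]^o).
Proof.
elim: s => [|j s IH].
  rewrite big_nil; apply: cvg_near_cst; apply: nearW => n.
  by rewrite /series /= big1 // => i _; rewrite big_nil.
rewrite big_cons.
have -> : series (fun i => \sum_(k <- j :: s) ip (e i) (v k) * ip (w k) (e i) : R[i]^o) =
    series (fun i => ip (w j) (e i) * ip (e i) (v j) : R[i]^o) +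
    series (fun i => \sum_(k <- s) ip (e i) (v k) * ip (w k) (e i) : R[i]^o).
  apply/funext => n; rewrite /series /= fctE -big_split /=.
  by apply: eq_bigr => i _; rewrite big_cons mulrC.
exact: cvgD (@parseval (v j) (w j)) IH.
Qed.

Lemma has_trace_comp_rank1_sum S (T : H -> H) us t : has_trace ip T t ->
  (forall x, T x = S (rank1_sum ip us x)) -> t = \sum_(u <- us) ip (S u) u.
Proof.
move=> /(_ e eB) Tt TE; have := @cvg_trace_sum _ us id S.
have -> : (fun i => \sum_(u <- us) ip (e i) u * ip (S u) (e i)) =
          (fun i => ip (T (e i)) (e i)).
  apply/funext => i; rewrite TE /rank1_sum op_sum ip_suml.
  by apply: eq_bigr => u _; rewrite opZ ipZl.
by move=> /(cvg_unique (@norm_hausdorff _ _) Tt).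
Qed.

End Basis.

Lemma seq_of_countable (D : set H) : countable D -> D !=set0 ->
  exists d : nat -> H, forall x, D x -> exists n, d n = x.
Proof.
move=> /pcard_leP[f] [x0 Dx0]; exists (fun n => xget x0 [set x | D x /\ f x = n]) => x Dx.
exists (f x); have := xgetPex x0 (ex_intro [set y | D y /\ f y = f x] x (conj Dx erefl)).
by move=> [Dy]; apply: (@inj _ _ D f); rewrite inE.
Qed.

(** Gram-Schmidt along a dense sequence [d]. When [d n] already lies in the span, infinite dimension
    supplies a fresh vector, so each step adds exactly one. Traces are defined by quantifying over
    bases, so they say nothing until one basis exists. *)
Lemma exists_orthonormal_basis : separable H -> infinite_dimensional H ->
  exists e, orthonormal_basis ip e.
Proof.
move=> [D [cD dD]] Hinf.
have D0 : D !=set0.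
  by have [x [_ Dx]] := dD setT (ex_intro _ 0 I) openT; exists x.
have [d dE] := seq_of_countable cD D0.
have fresh us : orthonormal ip us -> exists v, orthonormal ip (v :: us).
  move=> ous; have [spn|] := pselect (forall x, x = rank1_sum ip us x).
    exfalso; apply: (@Hinf (size us) (fun i => us`_i)); apply/seteqP; split=> // x _.
    exists (fun i => ip x us`_i); rewrite {1}[x]spn /rank1_sum (big_nth 0) big_mkord //.
  by move=> /existsNP[x /eqP/(orthonormal_extend ous)[r + _]]; exists (r%:C *: (x - rank1_sum ip us x)).
have step n us : orthonormal ip us ->
    exists v, orthonormal ip (v :: us) /\ d n = rank1_sum ip (v :: us) (d n).
  move=> ous; have [dn|] := eqVneq (d n) (rank1_sum ip us (d n)).
    have [v ov] := fresh us ous; exists v; split=> //.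
    rewrite rank1_sum_cons -dn -[LHS]add0r; congr (_ + _).
    suff -> : ip (d n) v = 0 by rewrite scale0r.
    rewrite dn rank1_sum_ip big_seq big1 // => u uus.
    by have /orthonormal_cons[_ /(_ u uus)/ip_eq0C-> _] := ov; rewrite mulr0.
  by move=> /(orthonormal_extend ous)[r o1 o2]; exists (r%:C *: (d n - rank1_sum ip us (d n))).
have [nx nxP] : exists nx : nat -> seq H -> H, forall n us, orthonormal ip us ->
    orthonormal ip (nx n us :: us) /\ d n = rank1_sum ip (nx n us :: us) (d n).
  exists (fun n us => xget 0 [set v | orthonormal ip (v :: us) /\ d n = rank1_sum ip (v :: us) (d n)]).
  by move=> n us /(step n)/(xgetPex 0).
pose L := fix L n := if n is n'.+1 then nx n' (L n') :: L n' else [::].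
have oL n : orthonormal ip (L n) by elim: n => // n IH; exact: (nxP n (L n) IH).1.
pose e n := nx n (L n).
have eL i n : (i < n)%N -> e i \in L n.
  elim: n => // n IH; rewrite ltnS leq_eqVlt => /orP[/eqP->|/IH ein].
    by rewrite /= mem_head.
  by rewrite /= inE ein orbT.
have ee i j : (i < j)%N -> ip (e j) (e i) = 0.
  by move=> ij; have /orthonormal_cons[_ + _] := oL j.+1; apply; exact: eL.
have LE n x : rank1_sum ip (L n) x = series (fun i => ip x (e i) *: e i) n.
  elim: n => [|n IH]; first by rewrite /rank1_sum /series /= big_nil big_nat big_pred0.
  by rewrite /= rank1_sum_cons IH /series /= big_nat_recr //= addrC.
exists e; split=> [i j|x].
  have [->|] := eqVneq i j; first by have /orthonormal_cons[] := oL j.+1.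
  by rewrite neq_ltn => /orP[/ee/ip_eq0C|/ee].
have dL m n : (m < n)%N -> rank1_sum ip (L n) (d m) = d m.
  elim: n => // n IH; rewrite ltnS leq_eqVlt => /orP[/eqP->|mn].
    by rewrite -(nxP n (L n) (oL n)).2.
  rewrite /= rank1_sum_cons (IH mn) -[RHS]add0r; congr (_ + _).
  suff -> : ip (d m) (nx n (L n)) = 0 by rewrite scale0r.
  rewrite -(IH mn) rank1_sum_ip big_seq big1 // => u uL.
  by have /orthonormal_cons[_ /(_ u uL)/ip_eq0C-> _] := oL n.+1; rewrite mulr0.
apply/cvg_nsqP => eps eps0.
have nx_eps : nbhs x [set y | nsq ip (x - y) < eps].
  by have := (@cvg_nsqP _ (nbhs x) _ id x).1; apply.
have [y [/interior_subset/= xy Dy]] : [set y | nsq ip (x - y) < eps]^° `&` D !=set0.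
  by apply: dD; [exists x | exact: open_interior].
have [m dm] := dE y Dy.
exists m.+1 => // n /= mn; rewrite -LE; apply: le_lt_trans xy.
rewrite -lecR -!ipxx.
(* As [y = d m] lies in the span of [L n], the points [x] and [x - y] have the same residual, which
   is no longer than [x - y]. *)
have -> : x - rank1_sum ip (L n) x = (x - y) - rank1_sum ip (L n) (x - y).
  by rewrite linearB /= -dm dL // opprB addrA subrK.
by rewrite resid_quad // lerBlDr lerDl rank1_sum_quad sumr_ge0 // => u _; rewrite exprn_ge0.
Qed.
End Hilbert.

(** * Projections of infinite and of finite trace *)

Section Trace.
Variables (R : realType) (H : completeNormedModType R[i]).
Variable ip : {dot H for Num.conj}.
Hypothesis hip : hilbert_product ip.
Implicit Types (x y z u v w : H) (a b : R[i]) (S T P : {linear H -> H}).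
Implicit Types (us vs : seq H) (e : nat -> H).

Lemma Re_sum (I : Type) (s : seq I) (p : pred I) (F : I -> R[i]) :
  complex.Re (\sum_(i <- s | p i) F i) = \sum_(i <- s | p i) complex.Re (F i).
Proof. by elim/big_rec2: _ => // i y1 y2 _ <-; case: (F i) => ? ?; case: y2. Qed.

Lemma Re_le_norm a : `|complex.Re a| <= rnorm a.
Proof.
by rewrite /rnorm normc_def /= -sqrtr_sqr ler_wsqrtr // lerDl sqr_ge0.
Qed.

Lemma cvg_Re (I : Type) (F : set_system I) {FF : Filter F} (f : I -> R[i]^o) (a : R[i]^o) :
  f @ F --> a -> (fun i => complex.Re (f i)) @ F --> complex.Re a.
Proof.
move=> /cvgrPdist_lt fa; apply/cvgrPdist_lt => eps eps0.
have /fa : 0 < eps%:C by rewrite ltcR.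
apply: filterS => i; rewrite normE ltcR; apply: le_lt_trans.
apply: le_trans (Re_le_norm _).
by case: (a) (f i) => ? ? [].
Qed.

Lemma orth_proj_rank1_sum P us : orth_proj ip P -> orthonormal ip us ->
  (forall u, u \in us -> P u = u) -> (forall x, P x = x -> x = rank1_sum ip us x) ->
  forall x, P x = rank1_sum ip us x.
Proof.
move=> [PP PS] ous Pus us1 x; rewrite {1}[P x]us1 //= /rank1_sum.
by apply: eq_big_seq => u /Pus uP; rewrite PS uP.
Qed.

Lemma rank1_sum_le_orth_proj P us x : orth_proj ip P -> orthonormal ip us ->
  (forall u, u \in us -> P u = u) -> ip (rank1_sum ip us x) x <= ip (P x) x.
Proof.
move=> [PP PS] ous Pus; have := bessel (P x) ous.
suff -> : ip (rank1_sum ip us (P x)) (P x) = ip (rank1_sum ip us x) x.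
  by rewrite -PS PP.
by rewrite !rank1_sum_ip; apply: eq_big_seq => u /Pus uP; rewrite PS uP -[ip u (P x)]PS uP.
Qed.

Lemma subspace_fix P : subspace [set x | P x = x].
Proof. by split=> /= [|a x y Px Py]; rewrite ?linear0 // opD opZ Px Py. Qed.

Lemma orthonormal_mkseq e n : (forall i j, ip (e i) (e j) = (i == j)%:R) ->
  orthonormal ip (mkseq e n).
Proof.
move=> ee; apply/andP; split; first by apply/allP => ? /mapP[i _ ->]; rewrite ee eqxx.
apply/(pairwiseP 0) => i j; rewrite !inE !size_mkseq => ni nj ij.
by rewrite !nth_mkseq // ee ltn_eqF.
Qed.

Lemma sum_orthonormal us : orthonormal ip us -> \sum_(u <- us) ip u u = (size us)%:R.
Proof.
move=> ous; rewrite big_seq (eq_bigr (fun=> 1)) => [|u uus]; last first.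
  by have /andP[/allP/(_ u uus)/eqP] := ous.
by rewrite -big_seq big_const_seq count_predT iter_addr_0.
Qed.

(** Otherwise the range of [P] is spanned by a finite orthonormal list [us]; exchanging sums and
    applying Bessel to each [u] bounds the trace by [size us]. *)
Lemma infinite_trace_orthonormal P m : separable H -> infinite_dimensional H ->
  orth_proj ip P -> infinite_trace ip P ->
  exists us, [/\ orthonormal ip us, forall u, u \in us -> P u = u & size us = m].
Proof.
move=> Hsep Hinf PP Ptr.
have [//|[us [ous Pus _ us1]]] := orthonormal_or_spanning ip m (subspace_fix P).
have PE := orth_proj_rank1_sum PP ous Pus us1.
have [e eB] := exists_orthonormal_basis hip Hsep Hinf.
exfalso; have := Ptr e eB; apply/eqP; rewrite lt_eqF //.
apply: (@le_lt_trans _ _ (size us)%:R%:E); last by rewrite ltry.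
have pos i : (0 <= (complex.Re (ip (P (e i)) (e i)))%:E)%E.
  by rewrite lee_fin -ler0c ReK PE rank1_sum_quad sumr_ge0 // => u _; rewrite exprn_ge0.
apply: lime_le; first by apply: is_cvg_nneseries => i _ _; exact: pos.
apply: nearW => n; rewrite sumEFin lee_fin -Re_sum -lecR ReK; last first.
  by apply: sumr_ge0 => i _; rewrite PE rank1_sum_quad sumr_ge0 // => u _; rewrite exprn_ge0.
under eq_bigr do rewrite PE rank1_sum_quad.
rewrite exchange_big /= rmorph_nat.
rewrite -sum_orthonormal //; apply: ler_sum => u _.
have := bessel u (orthonormal_mkseq n eB.1); apply: le_trans.
rewrite rank1_sum_quad big_map /index_iota subn0.
by under eq_bigr do rewrite ipC norm_conjC.
Qed.

(** With [r.+1] orthonormal fixed vectors, [P] would dominate a projection of trace [r.+1]. So its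
    range is spanned by a finite list, whose length is the trace. *)
Lemma finite_trace_rank1_sum P r : separable H -> infinite_dimensional H ->
  orth_proj ip P -> has_trace ip P r%:R ->
  exists us, [/\ orthonormal ip us, size us = r & forall x, P x = rank1_sum ip us x].
Proof.
move=> Hsep Hinf PP Ptr.
have [e eB] := exists_orthonormal_basis hip Hsep Hinf.
have [[us [ous Pus us_r]]|[us [ous Pus _ us1]]] :=
    orthonormal_or_spanning ip r.+1 (subspace_fix P); last first.
  exists us; split=> //; last exact: orth_proj_rank1_sum.
  have := has_trace_comp_rank1_sum hip (S := idfun) eB Ptr (orth_proj_rank1_sum PP ous Pus us1).
  rewrite sum_orthonormal // => /eqP.
  by rewrite eqr_nat => /eqP.
have h2 := cvg_Re (FF := eventually_filter) (@cvg_trace_sum _ _ _ hip _ eB _ us id id).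
have h1 := cvg_Re (FF := eventually_filter) (Ptr e eB).
have : complex.Re (\sum_(u <- us) ip u u) <= complex.Re (r%:R : R[i]).
  apply: (ler_cvg_to h2 h1); apply: nearW => n.
  rewrite /series /= !Re_sum; apply: ler_sum => i _.
  rewrite -lecR !ReK.
  - by rewrite -rank1_sum_ip; exact: rank1_sum_le_orth_proj.
  - by rewrite (le_trans _ (rank1_sum_le_orth_proj _ PP ous Pus)) // rank1_sum_quad
      sumr_ge0 // => u _; rewrite exprn_ge0.
  - by rewrite -rank1_sum_ip rank1_sum_quad sumr_ge0 // => u _; rewrite exprn_ge0.
rewrite sum_orthonormal // us_r.
have ReN k : complex.Re (k%:R : R[i]) = k%:R by rewrite -(rmorph_nat (real_complex R)).
by rewrite !ReN ler_nat ltnn.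
Qed.

End Trace.

(** * Spectral measures *)

Section SpectralMeasure.
Variables (R : realType) (H : completeNormedModType R[i]).
Variable ip : {dot H for Num.conj}.
Hypothesis hip : hilbert_product ip.
Variables (S : {linear H -> H}) (E : set (measurableTypeR R) -> {linear H -> H}).
Hypothesis SE : spectral_measure ip S E.
Implicit Types (x y z : H) (A B D : set (measurableTypeR R)).

Section Vector.
Variable x : H.

(* Measures of the library are nonnegative on all sets, while nothing is known
   of [E A] when [A] is not measurable. *)
Definition spectral_mu A : \bar R :=
  if `[< measurable A >] then (complex.Re (ip (E A x) x))%:E else 0%E.

Lemma spectral_muE A : measurable A -> spectral_mu A = (nsq ip (E A x))%:E.
Proof.
move=> mA; rewrite /spectral_mu asboolT //; congr EFin.
by have [EE ES] := spectral_proj SE mA; rewrite /nsq -ES EE.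
Qed.

Lemma spectral_muEip A : measurable A -> spectral_mu A = (complex.Re (ip (E A x) x))%:E.
Proof. by move=> mA; rewrite /spectral_mu asboolT. Qed.

(** For the constant sequence of empty sets the partial sums [n E(set0) x] converge to [E(set0) x];
    any index [n >= 2] bounds [|E(set0) x|] by the error. *)
Lemma spectral_set0 : E set0 x = 0.
Proof.
have := @spectral_sigma_additive _ _ _ _ _ SE _ (fun=> measurable0) (@trivIset_set0 _ _ setT) x.
rewrite bigcup0 // => /(cvg_nsqP hip) h; apply/eqP; rewrite -(nsq_eq0 ip).
rewrite eq_le nsq_ge0 andbT; apply/ler_addgt0Pr => eps eps0; rewrite add0r.
have [N _ /(_ (maxn N 2) (leq_maxl _ _))] := h eps eps0.
rewrite /= /series /= sumr_const_nat subn0 -scaler_nat -{1}[E set0 x]scale1r -scalerBl.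
have -> : (1 - (maxn N 2)%:R : R[i]) = (1 - (maxn N 2)%:R : R)%:C by rewrite rmorphB rmorph1 rmorph_nat.
rewrite nsqZr => /ltW; apply: le_trans; rewrite ler_peMl ?nsq_ge0 //.
have : 2%:R <= (maxn N 2)%:R :> R by rewrite ler_nat leq_maxr.
by move=> ?; nra.
Qed.

Lemma spectral_mu0 : spectral_mu set0 = 0%E.
Proof. by rewrite spectral_muE // spectral_set0 nsq0. Qed.

Lemma spectral_mu_ge0 A : (0 <= spectral_mu A)%E.
Proof.
have [mA|nA] := pselect (measurable A); first by rewrite spectral_muE // lee_fin nsq_ge0.
by rewrite /spectral_mu asboolF.
Qed.

Lemma spectral_mu_sigma_additive : semi_sigma_additive spectral_mu.
Proof.
move=> F mF tF mUF; rewrite spectral_muEip //.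
apply: cvg_EFin; first by apply: nearW => n; rewrite sum_fin_num; apply/allP => ? /mapP[i _ ->]; rewrite spectral_muE.
set g := (X in X @ _ --> _).
have -> : g = (fun n => complex.Re (ip (series (fun i => E (F i) x) n) x)).
  apply/funext => n; rewrite /g /= /series /= ip_suml Re_sum.
  under eq_bigr do rewrite spectral_muEip //.
  by rewrite sumEFin.
apply: cvg_Re; apply: (cvg_ip hip).
exact: (@spectral_sigma_additive _ _ _ _ _ SE _ mF tF x).
Qed.

HB.instance Definition _ := isMeasure.Build _ _ _ spectral_mu
  spectral_mu0 spectral_mu_ge0 spectral_mu_sigma_additive.

Definition spectral_measure_at : {measure set (measurableTypeR R) -> \bar R} := spectral_mu.

Lemma spectral_muT : spectral_measure_at setT = (nsq ip x)%:E.
Proof. by rewrite /spectral_measure_at /= spectral_muE // (spectral_total SE). Qed.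

Lemma spectral_muDI D : measurable D ->
  spectral_measure_at setT = (spectral_measure_at (~` D) + spectral_measure_at D)%E.
Proof.
by move=> mD; have := measureDI spectral_measure_at measurableT mD; rewrite setTI setTD.
Qed.

Lemma spectral_muC D : measurable D -> E D x = x -> spectral_measure_at (~` D) = 0%E.
Proof.
move=> mD Dx; have := spectral_muDI mD.
rewrite spectral_muT {2}/spectral_measure_at /= (spectral_muE mD) Dx.
move=> e; have : spectral_measure_at (~` D) \is a fin_num.
  by rewrite /spectral_measure_at /= spectral_muE //; exact: measurableC.
rewrite /spectral_measure_at /=; move: e; case: (spectral_mu _) => // r.
by rewrite -EFinD => -[e] _; congr EFin; lra.
Qed.

Lemma spectral_muC0 D : measurable D -> spectral_measure_at (~` D) = 0%E -> E D x = x.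
Proof.
move=> mD D0; have := spectral_muDI mD.
rewrite spectral_muT D0 add0e /spectral_measure_at /= (spectral_muEip mD) => -[xE].
have [EE ES] := spectral_proj SE mD.
apply/eqP; rewrite -subr_eq0 -(nsq_eq0 ip) /nsq; apply/eqP.
have -> : ip (E D x - x) (E D x - x) = ip x x - ip (E D x) x.
  have e1 : ip (E D x) (E D x) = ip (E D x) x by rewrite -ES EE.
  by rewrite ipBl !ipBr e1 -ES; ring.
by move: xE; rewrite /nsq; case: (ip (E D x) x) (ip x x) => a b [c d] /= ->; rewrite subrr.
Qed.

Import HBNNSimple.

(** The integral is built from simple functions, whose level sets are measurable, so values on other
    sets never enter. *)
Lemma spectral_integral_measure :
  (\int[fun A => (complex.Re (ip (E A x) x))%:E]_t t%:E =
   \int[spectral_measure_at]_t t%:E)%E.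
Proof.
have mh (h : {nnsfun (measurableTypeR R) >-> R}) r : spectral_measure_at (h @^-1` [set r]) =
    (complex.Re (ip (E (h @^-1` [set r]) x) x))%:E.
  by apply: spectral_muEip; exact: measurable_sfunP.
rewrite /integral.
congr (ereal_sup _ - ereal_sup _)%E; apply/seteqP; split=> _ [h hD <-].
- exists h => //; rewrite /sintegral; apply: eq_fsbigr => r _.
  by rewrite mh.
- exists h => //; rewrite /sintegral; apply: eq_fsbigr => r _.
  by rewrite mh.
- exists h => //; rewrite /sintegral; apply: eq_fsbigr => r _.
  by rewrite mh.
- exists h => //; rewrite /sintegral; apply: eq_fsbigr => r _.
  by rewrite mh.
Qed.

Lemma spectral_integral_bounds (a b : R) D : measurable D -> E D x = x ->
  D `<=` `[a, b] -> a * nsq ip x <= complex.Re (ip (S x) x) <= b * nsq ip x.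
Proof.
move=> mD Dx Dab.
rewrite (spectral_integral SE) /= spectral_integral_measure.
set mu := spectral_measure_at; have muC := spectral_muC mD Dx; rewrite -/mu in muC.
have muD : mu D = (nsq ip x)%:E by rewrite /mu /spectral_measure_at /= spectral_muE // Dx.
have -> : (\int[mu]_t t%:E = \int[mu]_(t in D) t%:E)%E.
  rewrite [RHS]integral_mkcond; apply: ae_eq_integral => //.
  - have mEF : measurable_fun D (EFin : measurableTypeR R -> \bar R).
      exact: EFin_measurable.
    by have [+ _] := measurable_restrictT (EFin : measurableTypeR R -> \bar R) mD; exact.
  - exists (~` D); split=> //; first exact: measurableC.
    by move=> t /=; apply: contra_not => Dt _; rewrite patchE mem_set.
have intD : mu.-integrable D EFin.
  apply: (@measurable_bounded_integrable _ _ _ mu id) => //; first by rewrite muD ltry.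
  exists (`|a| + `|b|); split=> // M hM t /= Dt; apply/ltW/(le_lt_trans _ hM).
  have := Dab _ Dt; rewrite /= in_itv /= => /andP[at_ tb].
  rewrite ler_norml; apply/andP; split.
    by have := ler_norm (- a); rewrite normrN => ?; have := normr_ge0 b; lra.
  by have := ler_norm b => ?; have := normr_ge0 a; lra.
have cstD r : mu.-integrable D (EFin \o cst r).
  apply: measurable_bounded_integrable => //; first by rewrite muD ltry.
  by exists `|r|; split=> // M hM t _ /=; exact: ltW.
have lo : (a%:E * (nsq ip x)%:E <= \int[mu]_(t in D) t%:E)%E.
  rewrite -muD -integral_cst //; apply: le_integral => // [|t /set_mem/Dab]; first exact: cstD.
  by rewrite /= in_itv /= lee_fin => /andP[].
have hi : (\int[mu]_(t in D) t%:E <= b%:E * (nsq ip x)%:E)%E.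
  rewrite -muD -integral_cst //; apply: le_integral => // [|t /set_mem/Dab]; first exact: cstD.
  by rewrite /= in_itv /= lee_fin => /andP[].
move: lo hi; rewrite -!EFinM; case: (\int[mu]_(t in D) t%:E)%E => //= r.
by rewrite !lee_fin => -> ->.
Qed.

Lemma spectral_bounded : exists2 M : R, 0 < M & E `[- M, M] x = x.
Proof.
have [M Mx] := spectral_bounded_support SE.
have M0 : spectral_measure_at (~` `[- M, M]) = 0%E by exact: spectral_muC.
exists (`|M| + 1); first by rewrite ltr_pwDr.
apply: spectral_muC0 => //; apply: (subset_measure0 _ _ _ M0); do ?exact: measurableC.
apply: subsetC => t /=; rewrite !in_itv /= => /andP[h1 h2].
have := ler_norm M; have := ler_norm (- M); rewrite normrN => h3 h4.
by apply/andP; split; lra.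
Qed.

End Vector.

Lemma spectral_lower x (a : R) D : measurable D -> E D x = x -> D `<=` `[a, +oo[ ->
  a * nsq ip x <= complex.Re (ip (S x) x).
Proof.
move=> mD Dx Da; have [M M0 Mx] := spectral_bounded x.
(* The two-sided estimate needs a bounded set; the bounded support allows [D] to be cut down without
   moving [x]. *)
have mDM : measurable (D `&` `[- M, M]) by exact: measurableI.
have DMx : E (D `&` `[- M, M]) x = x.
  apply: spectral_muC0 => //; rewrite setCI; apply: null_set_setU; do ?exact: measurableC.
    exact: spectral_muC.
  exact: spectral_muC.
suff /(spectral_integral_bounds mDM DMx)/andP[] : D `&` `[- M, M] `<=` `[a, M] by [].
by move=> t [/Da /=]; rewrite !in_itv /= andbT => -> /andP[_ ->].
Qed.

Lemma spectral_upper x (b : R) D : measurable D -> E D x = x -> D `<=` `]-oo, b] ->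
  complex.Re (ip (S x) x) <= b * nsq ip x.
Proof.
move=> mD Dx Db; have [M M0 Mx] := spectral_bounded x.
have mDM : measurable (D `&` `[- M, M]) by exact: measurableI.
have DMx : E (D `&` `[- M, M]) x = x.
  apply: spectral_muC0 => //; rewrite setCI; apply: null_set_setU; do ?exact: measurableC.
    exact: spectral_muC.
  exact: spectral_muC.
suff /(spectral_integral_bounds mDM DMx)/andP[] : D `&` `[- M, M] `<=` `[- M, b] by [].
by move=> t [/Db /=]; rewrite !in_itv /= => -> /andP[-> _].
Qed.

(** On the range of [E (B n)] the form is at least [N + 1 / (n + 1)] times the squared norm, so this
    range is zero; the sets [B n] exhaust the half-line. *)
Lemma spectral_above (N : R) x : (forall y, complex.Re (ip (S y) y) <= N * nsq ip y) ->
  spectral_measure_at x `]N, +oo[%classic = 0%E.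
Proof.
move=> SN; pose B n : set (measurableTypeR R) := `[N + n.+1%:R^-1, +oo[%classic.
have EB n y : E (B n) y = 0.
  have mB : measurable (B n) by exact: measurable_itv.
  have [EE _] := spectral_proj SE mB.
  apply/eqP; rewrite -(nsq_eq0 ip) eq_le nsq_ge0 andbT.
  have := @spectral_lower (E (B n) y) (N + n.+1%:R^-1) (B n) mB (EE y) (@subset_refl _ _).
  move=> /le_trans/(_ (SN _)); rewrite mulrDl gerDl pmulr_rle0 // invr_gt0 ltr0n //.
have -> : `]N, +oo[%classic = \bigcup_n B n.
  apply/seteqP; split=> t /=; rewrite ?in_itv /= ?andbT.
    move=> Nt; have t0 : 0 < t - N by rewrite subr_gt0.
    have [n nt] := ltr_add_invr t0; exists n => //=; rewrite /B /= ?set_itvE /=.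
    rewrite in_itv /= andbT.
    by move: nt; rewrite add0r ltrBrDl => /ltW.
  move=> [n _]; rewrite /B /= in_itv /= andbT; apply: lt_le_trans.
  by rewrite ltrDl.
apply: measure_negligible; first by apply: bigcupT_measurable => n; exact: measurable_itv.
apply: negligible_bigcup => n; apply/negligibleP; first exact: measurable_itv.
by rewrite /spectral_measure_at /= spectral_muE ?EB ?nsq0 //; exact: measurable_itv.
Qed.

(** The measure of [x] has no mass on [[s, N]] by assumption and none above [N], so it is carried by
    the numbers below [s]. *)
Lemma spectral_complement (s N : R) x :
  (forall y, complex.Re (ip (S y) y) <= N * nsq ip y) ->
  E `[s, N]%classic x = 0 -> complex.Re (ip (S x) x) <= s * nsq ip x.
Proof.
move=> SN x0; apply: (@spectral_upper x s `]-oo, s[%classic) => //.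
  apply: spectral_muC0 => //; rewrite setCitvl /=.
  have := spectral_above x SN.
  have muA : spectral_measure_at x `[s, N]%classic = 0%E.
    by rewrite /spectral_measure_at /= spectral_muE // x0 nsq0.
  move=> muB; rewrite (_ : `[s, +oo[%classic = `[s, N]%classic `|` (`]N, +oo[%classic `&` `[s, +oo[%classic)).
    apply: null_set_setU => //; first exact: measurableI.
    by apply: subset_measure0 muB => //; exact: measurableI.
  apply/seteqP; split=> t /=; rewrite !in_itv /= ?andbT.
    by move=> ->; have [tN|Nt] := leP t N; [left|right].
  by move=> [/andP[]//|[]].
by move=> t /=; rewrite !in_itv /=; exact: ltW.
Qed.

End SpectralMeasure.

(** * The essential norm *)

Section Operator.
Variables (R : realType) (H : completeNormedModType R[i]).
Variable ip : {dot H for Num.conj}.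
Hypothesis hip : hilbert_product ip.
Implicit Types (x y z u v w : H) (a b : R[i]) (S T K : {linear H -> H}).
Implicit Types (us vs ws : seq H).

Lemma rnorm0 : rnorm (0 : H) = 0.
Proof. by rewrite /rnorm normr0. Qed.

Lemma rnormD (V : normedZmodType R[i]) (x y : V) : rnorm (x + y) <= rnorm x + rnorm y.
Proof. by rewrite -lecR rmorphD /= -!normE ler_normD. Qed.

Lemma rnormB (V : normedZmodType R[i]) (x y : V) : rnorm (x - y) = rnorm (y - x).
Proof. by rewrite /rnorm distrC. Qed.

Lemma rnormN (V : normedZmodType R[i]) (x : V) : rnorm (- x) = rnorm x.
Proof. by rewrite /rnorm normrN. Qed.

Lemma rnormZ a x : rnorm (a *: x) = rnorm a * rnorm x.
Proof. by apply: (@complexI R); rewrite rmorphM /= -!normE normrZ. Qed.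

Lemma rnorm_eq0 x : (rnorm x == 0) = (x == 0).
Proof. by rewrite -(inj_eq (@complexI R)) /= -normE normr_eq0. Qed.

Lemma rnorm_real (r : R) : rnorm (r%:C : R[i]) = `|r|.
Proof. by apply: (@complexI R); rewrite -normE normc_def /= expr0n addr0 sqrtr_sqr. Qed.

Lemma Re_ip_le x y : complex.Re (ip x y) <= rnorm x * rnorm y.
Proof.
apply: le_trans (rnorm_CauchySchwarz hip x y); apply: le_trans (Re_le_norm _).
exact: ler_norm.
Qed.

(** Its supremum is [op_norm T], which is 0 by convention when the set is unbounded; an upper bound
    must therefore be established before [op_norm] estimates anything. *)
Definition image_norms (T : H -> H) := [set rnorm (T x) | x in [set x : H | rnorm x <= 1]].

Lemma op_norm_ge0 T : 0 <= op_norm T.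
Proof.
have [ub|nub] := pselect (has_ubound (image_norms T)); last first.
  by rewrite /op_norm sup_out // => -[].
apply: (@ub_le_sup _ (image_norms T)) => //; exists 0; rewrite ?linear0 /= ?rnorm0 //.
Qed.

Lemma op_norm_le_of_image T x : has_ubound (image_norms T) ->
  rnorm (T x) <= op_norm T * rnorm x.
Proof.
move=> ub; have [->|x0] := eqVneq x 0; first by rewrite linear0 rnorm0 mulr0.
have xn : 0 < rnorm x by rewrite lt_def rnorm_eq0 x0 rnorm_ge0.
rewrite -ler_pdivrMr // mulrC; apply: (@ub_le_sup _ (image_norms T)) => //.
exists ((rnorm x)^-1%:C *: x).
  by rewrite /= rnormZ rnorm_real ger0_norm ?invr_ge0 ?rnorm_ge0 // mulVf ?gt_eqF.
by rewrite opZ rnormZ rnorm_real ger0_norm ?invr_ge0 ?rnorm_ge0.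
Qed.

Lemma bounded_image T : bounded_op T -> has_ubound (image_norms T).
Proof.
move=> [M TM]; exists (`|M|) => _ [x /= x1 <-]; apply: le_trans (TM x) _.
apply: (@le_trans _ _ (`|M| * rnorm x)); first by rewrite ler_wpM2r ?rnorm_ge0 // ler_norm.
by rewrite ler_piMr.
Qed.

Lemma op_normP T x : bounded_op T -> rnorm (T x) <= op_norm T * rnorm x.
Proof. by move=> /bounded_image; exact: op_norm_le_of_image. Qed.

Lemma op_norm_quad T x : bounded_op T -> complex.Re (ip (T x) x) <= op_norm T * nsq ip x.
Proof.
move=> Tb; apply: le_trans (Re_ip_le _ _) _; rewrite nsqE // expr2 mulrA.
by rewrite ler_wpM2r ?rnorm_ge0 // op_normP.
Qed.

Lemma op_norm_le T (t : R) : (forall x, rnorm x <= 1 -> rnorm (T x) <= t) -> op_norm T <= t.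
Proof.
move=> h; apply: ge_sup; last by move=> _ [x x1 <-]; exact: h.
by exists (rnorm (T 0)), 0 => //=; rewrite rnorm0.
Qed.

Lemma rnorm_continuous : continuous (@rnorm R H).
Proof.
move=> x; apply/cvgrPdist_lt => eps eps0.
have : nbhs x (ball x eps%:C) by apply: nbhsx_ballx; rewrite ltcR.
apply: filterS => y; rewrite -ball_normE /= normE ltcR; apply: le_lt_trans.
rewrite ler_norml; apply/andP; split.
  by rewrite lerNl opprB lerBlDr rnormB -{1}[y](subrK x) rnormD.
by rewrite lerBlDr -{1}[x](subrK y) rnormD.
Qed.

Lemma compact_image_bounded K : compact_op K -> has_ubound (image_norms K).
Proof.
move=> cK; have : compact (@rnorm R H @` closure (K @` [set x : H | rnorm x <= 1])).
  by apply: continuous_compact => //; apply: continuous_subspaceT; exact: rnorm_continuous.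
move=> /compact_bounded[M [_ /(_ (M + 1))]]; rewrite ltrDl ltr01 => /(_ isT) h.
exists (M + 1) => _ [x x1 <-]; apply: le_trans (h (rnorm (K x)) _); first exact: ler_norm.
by exists (K x) => //; apply: subset_closure; exists x.
Qed.

Lemma image_norms_add S K : has_ubound (image_norms S) -> has_ubound (image_norms K) ->
  has_ubound (image_norms (S \+ K)).
Proof.
move=> [M Mub] [N Nub]; exists (M + N) => _ [x x1 <-].
by apply: le_trans (rnormD _ _) _; apply: lerD; [apply: Mub|apply: Nub]; exists x.
Qed.

(** In fact a closed square: it contains the disk of radius [M], and is compact as the image of a
    product of segments. *)
Definition disk (M : R) : set (R[i]^o) :=
  (fun p : R * R => p.1 +i* p.2 : R[i]^o) @` (`[- M, M] `*` `[- M, M]).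

Lemma disk_rnorm M a : rnorm a <= M -> disk M a.
Proof.
move=> aM; exists (complex.Re a, complex.Im a); last by case: a aM.
have lM (r : R) : r ^+ 2 <= complex.Re a ^+ 2 + complex.Im a ^+ 2 -> - M <= r <= M.
  rewrite -ler_norml => h; apply: le_trans aM; rewrite /rnorm normc_def /=.
  by rewrite -sqrtr_sqr ler_wsqrtr.
by split; rewrite /= in_itv /= lM // ?lerDl ?lerDr sqr_ge0.
Qed.

Lemma compact_disk (M : R) : compact (disk M).
Proof.
apply: continuous_compact; last by apply: compact_setX; exact: segment_compact.
apply: continuous_subspaceT => p; apply/cvgrPdist_lt => eps eps0.
have epsE : eps = (complex.Re eps)%:C by rewrite ReK // ltW.
have e0 : 0 < complex.Re eps / 2 by rewrite divr_gt0 // -ltcR -epsE.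
have : nbhs p (ball p (complex.Re eps / 2)) by exact: nbhsx_ballx.
apply: filterS => q [/=]; rewrite -!ball_normE /= => h1 h2.
rewrite epsE normE ltcR.
have -> : (p.1 +i* p.2) - (q.1 +i* q.2) = (p.1 - q.1)%:C + (p.2 - q.2)%:C * 'i%C.
  by apply/eqP; rewrite eq_complex /= !mulr0 !mul0r !mulr1 subr0 !addr0 add0r !eqxx.
apply: le_lt_trans (rnormD _ _) _; rewrite rnorm_real.
have -> : rnorm ((p.2 - q.2)%:C * 'i%C : R[i]) = `|p.2 - q.2|.
  rewrite /rnorm normc_def /= !mulr0 !mul0r !mulr1 subr0 addr0 expr0n add0r.
  by rewrite sqrtr_sqr.
by rewrite [ltRHS]splitr ltrD.
Qed.

Fixpoint box (M : R) ws : set H :=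
  if ws is w :: ws then [set a *: w + y | a in disk M & y in box M ws] else [set 0].

Lemma compact_box M ws : compact (box M ws).
Proof.
elim: ws => [|w ws IH] /=; first exact: compact_set1.
have -> : [set a *: w + y | a in disk M & y in box M ws] =
          (fun p : R[i]^o * H => p.1 *: w + p.2) @` (disk M `*` box M ws).
  apply/seteqP; split=> [_ [a aM [y yM <-]]|_ [[a y] [/= aM yM] <-]].
    by exists (a, y).
  by exists a => //; exists y.
apply: continuous_compact; last first.
  have := compact_setX (@compact_disk M) IH; exact.
apply: continuous_subspaceT => p; apply: cvgD; last exact: cvg_snd.
by apply: cvgZr_tmp; exact: cvg_fst.
Qed.

Lemma finite_rank_compact K (J : Type) (s : seq J) (w : J -> H) (a : J -> H -> R[i]) (M : R) :
  (forall x, K x = \sum_(j <- s) a j x *: w j) ->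
  (forall j x, rnorm x <= 1 -> rnorm (a j x) <= M) -> compact_op K.
Proof.
move=> KE aM.
have cb : compact (box M (map w s)) by exact: compact_box.
apply: (subclosed_compact (@closed_closure _ _) cb).
have /closure_id -> : closed (box M (map w s)).
  by apply: compact_closed cb; exact: norm_hausdorff.
apply: closure_subset => _ [x x1 <-]; rewrite KE.
elim: s {KE cb} => [|j s IH] /=; first by rewrite big_nil.
by rewrite big_cons; exists (a j x); [exact/disk_rnorm/aM|exists (\sum_(j <- s) a j x *: w j)].
Qed.

(** Cauchy-Schwarz at [x] and [T x] gives [|T x|^4 <= t |x|^2 * t |T x|^2]. *)
Lemma positive_norm_le T (t : R) x : positive_op ip T -> 0 <= t ->
  (forall y, ip (T y) y <= t%:C * ip y y) -> rnorm (T x) <= t * rnorm x.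
Proof.
move=> Tpos t0 Tt; rewrite -(@ler_pXn2r _ 2) ?nnegrE ?mulr_ge0 ?rnorm_ge0 //.
rewrite exprMn -!(nsqE hip) //.
have : (nsq ip (T x)) ^+ 2 <= (t * nsq ip x) * (t * nsq ip (T x)).
  rewrite -lecR rmorphXn /= -ipxx -[ip _ _]ger0_norm ?ip_ge0 //.
  apply: le_trans (positive_CauchySchwarz _ _ Tpos) _.
  rewrite !rmorphM /= -!ipxx; apply: ler_pM => //; exact: Tpos.
have [->|n0] := eqVneq (nsq ip (T x)) 0.
  by rewrite mulr_ge0 ?nsq_ge0 // sqr_ge0.
have np : 0 < nsq ip (T x) by rewrite lt_def n0 nsq_ge0.
by rewrite mulrA expr2 ler_pM2r // mulrAC -expr2 => /le_trans; apply.
Qed.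

Lemma ess_norm_le S K : compact_op K -> ess_norm S <= op_norm (S \+ K).
Proof.
move=> cK; apply: ge_inf; last by exists K.
by exists 0 => _ [K' _ <-]; exact: op_norm_ge0.
Qed.

Lemma ess_norm_lt S (t : R) : ess_norm S < t ->
  exists2 K : {linear H -> H}, compact_op K & op_norm (S \+ K) < t.
Proof.
move=> st; have [] := @inf_adherent _ [set op_norm (S \+ K) | K in [set K : {linear H -> H} | compact_op K]] (t - ess_norm S).
- by rewrite subr_gt0.
- split; last by exists 0 => _ [K _ <-]; exact: op_norm_ge0.
  exists (op_norm (S \+ (\0 : {linear H -> H}))), (\0 : {linear H -> H}) => //.
  apply: (@finite_rank_compact _ nat [::] (fun=> 0) (fun _ _ => 0) 0) => [x|_ x _].
    by rewrite big_nil.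
  by rewrite rnorm_real normr0.
by move=> _ [K cK <-]; rewrite addrC subrK; exists K.
Qed.

Lemma spacious_ess_norm S (t : R) : positive_op ip S -> bounded_op S -> 0 <= t ->
  t < ess_norm S -> spacious ip S t.
Proof.
move=> Spos Sb t0 ts vs.
have [us ous usE] := exists_orthonormal_span ip vs.
apply: contrapT => /forallNP no.
pose Q : {linear H -> H} := deflate ip idfun us.
have QE x : Q x = x - rank1_sum ip us x by [].
have Qus x u : u \in us -> ip (Q x) u = 0 by exact: resid_orth.
have QQ x y : ip (Q x) y = ip x (Q y).
  rewrite !QE ipBl ipBr; congr (_ - _); rewrite rank1_sum_ip [RHS]ip_sumr.
  by apply: eq_bigr => u _; rewrite ipZr -ipC mulrC.
have Qvs x v : v \in vs -> ip (Q x) v = 0.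
  move=> /usE vE; rewrite vE [LHS]ip_sumr big_seq big1 // => u uus.
  by rewrite ipZr Qus // mulr0.
have SQ x : ip (S (Q x)) (Q x) <= t%:C * ip (Q x) (Q x).
  have [Qx0|Qx0] := eqVneq (Q x) 0; first by rewrite Qx0 !ip0r mulr0.
  have n0 : 0 < nsq ip (Q x) by rewrite lt_def nsq_ge0 nsq_eq0 Qx0.
  pose r := Num.sqrt (nsq ip (Q x))^-1.
  have rE : r ^+ 2 * nsq ip (Q x) = 1 by rewrite sqr_sqrtr ?invr_ge0 ?ltW // mulVf // gt_eqF.
  have /not_and3P := no (r%:C *: Q x).
  rewrite ipxx nsqZr rE => -[//|[v vvs]|]; first by rewrite ipZl Qvs // mulr0.
  rewrite opZ ipZl ipZr conj_real mulrA -rmorphM -expr2 /= => /negP.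
  rewrite -(ReK (Spos (Q x))) -rmorphM lecR -ltNge => h.
  rewrite ipxx -rmorphM lecR -(ler_pM2l (_ : 0 < r ^+ 2)); last first.
    by rewrite sqr_sqrtr ?invr_ge0 ?ltW // invr_gt0.
  by rewrite mulrCA rE mulr1 ltW.
pose T : {linear H -> H} := Q \o (S \o Q).
have Tpos : positive_op ip T by move=> x; rewrite /= QQ; exact: Spos.
have Tt x : ip (T x) x <= t%:C * ip x x.
  rewrite /= QQ; apply: le_trans (SQ x) _; rewrite ler_wpM2l ?ler0c //.
  rewrite -[leRHS](subrK (ip (rank1_sum ip us x) x)) -resid_quad // lerDl.
  by rewrite rank1_sum_quad sumr_ge0 // => u _; rewrite exprn_ge0.
pose K : {linear H -> H} := T \- S.
have SKE : (S \+ K : H -> H) = T by apply/funext => x; rewrite /= addrC subrK.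
have cK : compact_op K.
  (* Writing [P] for the projection onto the span, [Q S Q - S = - P S - Q S P]; the left summands
     encode [- P S], the right ones [- Q S P]. *)
  pose a (j : H + H) x := match j with inl u => - ip (S x) u | inr u => - ip x u end.
  pose w (j : H + H) := match j with inl u => u | inr u => Q (S u) end.
  have us1 u : u \in us -> rnorm u = 1.
    move=> uus; have /andP[/allP/(_ u uus)/eqP u1 _] := ous.
    apply/eqP; rewrite -(@eqrXn2 _ 2) ?rnorm_ge0 // expr1n -(nsqE hip) //.
    by rewrite -(inj_eq (@complexI R)) /= -ipxx u1.
  (* The coefficients are set to 0 off [us], because the bound has to hold for every index of
     [H + H]. *)
  pose g (j : H + H) x := match j with
    | inl u => if u \in us then a j x else 0
    | inr u => if u \in us then a j x else 0 end.
  apply: (@finite_rank_compact _ _ (map inl us ++ map inr us) w g (Num.max 1 (op_norm S))).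
    move=> x; rewrite big_cat !big_map /g /=.
    under eq_big_seq => u -> do rewrite scaleNr.
    under [X in _ = _ + X]eq_big_seq => u -> do rewrite scaleNr.
    rewrite !sumrN [\sum_(u <- us) _](_ : _ = rank1_sum ip us (S x)) //.
    have -> : \sum_(u <- us) ip x u *: Q (S u) = Q (S (rank1_sum ip us x)).
      by rewrite /rank1_sum !op_sum; apply: eq_bigr => u _; rewrite !opZ.
    transitivity (Q (S (Q x)) - S x); first by [].
    rewrite [Q x]QE !opB [Q (S x)]QE.
    by rewrite addrAC [_ - _ - S x]addrAC subrr add0r.
  move=> j x x1.
  have gle u : u \in us -> rnorm (- ip (S x) u) <= Num.max 1 (op_norm S).
    move=> /us1 u1; rewrite rnormN (le_trans (rnorm_CauchySchwarz hip _ _)) // u1 mulr1.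
    rewrite (le_trans (op_normP _ Sb)) // le_max; apply/orP; right.
    by rewrite ler_piMr // op_norm_ge0.
  have hle u : u \in us -> rnorm (- ip x u) <= Num.max 1 (op_norm S).
    move=> /us1 u1; rewrite rnormN (le_trans (rnorm_CauchySchwarz hip _ _)) // u1 mulr1.
    by rewrite (le_trans x1) // le_max lexx.
  have r0 : rnorm (0 : R[i]) <= Num.max 1 (op_norm S) by rewrite rnorm_real normr0 le_max ler01.
  by case: j => u /=; case: ifPn => // uus; [exact: gle|exact: hle].
have := ess_norm_le S cK; rewrite SKE leNgt => /negP; apply; apply: le_lt_trans ts.
apply: op_norm_le => x x1; apply: le_trans (positive_norm_le x Tpos t0 Tt) _.
by rewrite ler_piMr.
Qed.

(** * Maxima of the form above the essential norm *)

Section Attain.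
Variables (S : {linear H -> H}) (lam : R) (vs : seq H).
Hypothesis Sb : bounded_op S.
Let W x := forall v, v \in vs -> ip x v = 0.
Let q x := lam * nsq ip x - complex.Re (ip (S x) x).
Hypothesis q_ge0 : forall x, W x -> 0 <= q x.
Hypothesis ess_lam : ess_norm S < lam.
Hypothesis sup_lam : forall eps, 0 < eps -> exists x, [/\ W x, nsq ip x = 1 & q x < eps].

Let nsqD x y : nsq ip (x + y) + nsq ip (x - y) = 2 * nsq ip x + 2 * nsq ip y.
Proof.
rewrite /nsq !ipDl !ipDr !ipNl !ipNr.
case: (ip x x) (ip x y) (ip y x) (ip y y) => [a a'] [b b'] [c c'] [d d'] /=; lra.
Qed.

Let parallelogram x y : q (x + y) + q (x - y) = 2 * q x + 2 * q y.
Proof.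
have : complex.Re (ip (S (x + y)) (x + y)) + complex.Re (ip (S (x - y)) (x - y)) =
    2 * complex.Re (ip (S x) x) + 2 * complex.Re (ip (S y) y).
  rewrite opB opD !ipDl !ipDr !ipNl !ipNr.
  case: (ip (S x) x) (ip (S x) y) (ip (S y) x) (ip (S y) y) => [a a'] [b b'] [c c'] [d d'] /=; lra.
by have := nsqD x y; rewrite /q; nra.
Qed.

Let WD x y : W x -> W y -> W (x + y).
Proof. by move=> Wx Wy v vvs; rewrite ipDl Wx // Wy // addr0. Qed.

Let WB x y : W x -> W y -> W (x - y).
Proof. by move=> Wx Wy v vvs; rewrite ipBl Wx // Wy // subr0. Qed.

(* A maximizing sequence along which [K x] converges is Cauchy, because
   [lam - (S + K)] is bounded below when [op_norm (S + K) < lam]. *)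
Lemma sup_attained : exists x, [/\ W x, nsq ip x = 1 & complex.Re (ip (S x) x) = lam].
Proof.
have [K cK tlam] := ess_norm_lt ess_lam; set t := op_norm _ in tlam.
have SKt x : rnorm ((S \+ K) x) <= t * rnorm x.
  apply: (@op_norm_le_of_image (S \+ K)).
  by apply: image_norms_add; [exact: bounded_image|exact: compact_image_bounded].
have n1 x : nsq ip x = 1 -> rnorm x = 1.
  by rewrite nsqE // => /eqP; rewrite sqrf_eq1 => /orP[/eqP//|/eqP e]; have := rnorm_ge0 x; rewrite e; lra.
(* The filter of near-maximizers plays the part of a maximizing sequence; compactness gives a
   cluster point [a] of [K] along it, and the sets [Y eps] below refine it so that [K] converges to
   [a]. *)
pose X eps := [set x | [/\ W x, nsq ip x = 1 & q x < eps]].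
pose F := filter_from [set eps : R | 0 < eps] X.
have FF : ProperFilter F.
  apply: filter_from_proper; last by move=> eps /sup_lam[x Xx]; exists x.
  apply: filter_from_filter; first by exists 1 => /=.
  move=> e1 e2 /= e10 e20; exists (Num.min e1 e2); first by rewrite /= lt_min e10.
  by move=> x [Wx x1]; rewrite lt_min => /andP[q1 q2].
have [|a [_ cla]] := cK (K @ F) _.
  exists 1 => //= x [_ x1 _]; apply: subset_closure; exists x => //=.
  by rewrite n1.
pose Y eps := X eps `&` [set x | rnorm (K x - a) < eps].
have Y0 eps : 0 < eps -> Y eps !=set0.
  move=> eps0; have epsC : 0 < eps%:C by rewrite ltcR.
  have [|y [[x Xx Kxy] /=]] := cla (K @` X eps) (ball a eps%:C) _ (nbhsx_ballx _ _ epsC).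
  - by exists eps => // x Xx; exists x.
  - by rewrite -ball_normE /= normE ltcR rnormB -Kxy => h; exists x.
pose G := filter_from [set eps : R | 0 < eps] Y.
have GG : ProperFilter G.
  apply: filter_from_proper; last by move=> eps /Y0.
  apply: filter_from_filter; first by exists 1 => /=.
  move=> e1 e2 /= e10 e20; exists (Num.min e1 e2); first by rewrite /= lt_min e10.
  by move=> x [[Wx x1]]; rewrite lt_min => /andP[q1 q2] /=; rewrite lt_min => /andP[k1 k2].
(* By the parallelogram law and [q (x + y) >= 0], [q (x - y) <= 4 eps]. Since [|K (x - y)| <= 2 eps]
   and [|x - y| <= 2], replacing [S] by [S + K] costs another [4 eps]. *)
have Ydist eps x y : 0 < eps -> Y eps x -> Y eps y -> (lam - t) * nsq ip (x - y) <= 8 * eps.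
  move=> eps0 [[Wx x1 qx] /= Kx] [[Wy y1 qy] /= Ky].
  have := parallelogram x y; have := q_ge0 (WD Wx Wy).
  have h1 : complex.Re (ip (S (x - y)) (x - y)) <= t * nsq ip (x - y) + 4 * eps.
    have -> : ip (S (x - y)) (x - y) = ip ((S \+ K) (x - y)) (x - y) + ip (- K (x - y)) (x - y).
      by rewrite -ipDl /= addrK.
    have -> (u v : R[i]) : complex.Re (u + v) = complex.Re u + complex.Re v by case: u v => ? ? [].
    apply: lerD; first by rewrite nsqE // expr2 mulrA (le_trans (Re_ip_le _ _)) // ler_wpM2r ?rnorm_ge0.
    apply: le_trans (Re_ip_le _ _) _; rewrite rnormN.
    have e1 : rnorm (K (x - y)) <= 2 * eps.
      have -> : K (x - y) = (K x - a) - (K y - a).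
        by rewrite opB opprB addrA subrK.
      by apply: le_trans (rnormD _ _) _; rewrite rnormN; lra.
    have e2 : rnorm (x - y) <= 2.
      by apply: le_trans (rnormD _ _) _; rewrite rnormN !n1.
    have := rnorm_ge0 (K (x - y)); have := rnorm_ge0 (x - y) => ? ?; nra.
  have qz : q (x - y) = lam * nsq ip (x - y) - complex.Re (ip (S (x - y)) (x - y)) by [].
  move=> h2 h3; rewrite mulrBl; lra.
have lt0 : 0 < lam - t by rewrite subr_gt0.
have /cvg_ex[x Gx] : cvg G.
  apply: cauchy_cvg; apply: cauchy_exP => eps eps0.
  have epsE : eps = (complex.Re eps)%:C by rewrite ReK // ltW.
  have e0 : 0 < complex.Re eps by rewrite -ltcR -epsE.
  pose eta := (lam - t) * complex.Re eps ^+ 2 / 16.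
  have eta0 : 0 < eta by rewrite !mulr_gt0 ?exprn_gt0 // invr_gt0.
  have [y Yy] := Y0 eta eta0; exists y; exists eta => // z Yz.
  rewrite -ball_normE /= normE epsE ltcR -(@ltr_pXn2r _ 2) ?nnegrE ?rnorm_ge0 ?(ltW e0) //.
  rewrite -(nsqE hip) -(ltr_pM2l lt0); apply: le_lt_trans (Ydist _ _ _ eta0 Yy Yz) _.
  have := mulr_gt0 lt0 (exprn_gt0 2 e0); rewrite /eta => ?; lra.
have GY eps : 0 < eps -> G (Y eps) by exists eps.
have Wx : W x.
  move=> v vvs; have h : (fun y => ip y v : R[i]^o) @ G --> (ip x v : R[i]^o).
    by apply: (cvg_ip hip Gx).
  apply: (cvg_unique (@norm_hausdorff _ _) h); apply: cvg_near_cst.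
  by apply: filterS (GY 1 ltr01) => y [[Wy _ _] _]; exact: Wy.
have x1 : nsq ip x = 1.
  rewrite (nsqE hip); suff -> : rnorm x = 1 by rewrite expr1n.
  have h : rnorm y @[y --> G] --> rnorm x := cvg_comp _ _ Gx (@rnorm_continuous x).
  apply: (cvg_unique (@norm_hausdorff _ _) h); apply: cvg_near_cst.
  by apply: filterS (GY 1 ltr01) => y [[_ y1 _] _]; exact: n1.
exists x; split=> //; suff q0 : q x <= 0 by have := q_ge0 Wx; move: q0; rewrite /q x1; lra.
apply/ler_addgt0Pr => eps eps0; rewrite add0r.
(* Passing to the limit again uses the parallelogram law, now for [y] and [x - y]: it gives [q x <=
   2 q y + 2 q (x - y) <= (2 + 2 C) eta = eps]. *)
pose C := `|lam| + op_norm S; have C0 : 0 <= C by rewrite addr_ge0 // op_norm_ge0.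
pose eta := eps / (2 + 2 * C).
have C2 : 0 < 2 + 2 * C by lra.
have eta0 : 0 < eta by rewrite divr_gt0.
have xG : \forall y \near G, nsq ip (x - y) < eta.
  by have := (@cvg_nsqP _ _ _ hip _ G _ id x).1; apply.
have [y [[[Wy _ qy] _] /= xy]] := filter_ex (filterI (GY eta eta0) xG).
have := parallelogram y (x - y); have := q_ge0 (WB Wy (WB Wx Wy)).
rewrite [y + (x - y)]addrC subrK => h1 h2.
have h3 : q (x - y) <= C * nsq ip (x - y).
  set z := x - y; rewrite /q mulrDl; apply: lerD.
    by rewrite ler_wpM2r ?nsq_ge0 // ler_norm.
  have <- : complex.Re (ip (- S z) z) = - complex.Re (ip (S z) z) by rewrite ipNl; case: (ip _ _).
  apply: le_trans (Re_ip_le _ _) _; rewrite rnormN (nsqE hip) expr2 mulrA.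
  by rewrite ler_wpM2r ?rnorm_ge0 // op_normP.
have h4 : C * nsq ip (x - y) <= C * eta by rewrite ler_wpM2l // ltW.
have h5 : eta * (2 + 2 * C) = eps by rewrite divfK // gt_eqF.
lra.
Qed.

End Attain.

End Operator.

(** * Exhausting an operator by rank one operators *)

Section Exhaust.
Variables (R : realType) (H : completeNormedModType R[i]).
Variable ip : {dot H for Num.conj}.
Hypothesis hip : hilbert_product ip.
Implicit Types (x y z u v w f g h : H) (a b : R[i]) (S T K : {linear H -> H}).
Implicit Types (fs gs : seq H).

Lemma deflate_perm T fs gs x : perm_eq fs gs -> deflate ip T fs x = deflate ip T gs x.
Proof. by move=> fg; rewrite /deflate /rank1_sum (perm_big _ fg). Qed.

Lemma spacious_deflate_many T (t : R) fs p : spacious ip T t -> 0 <= t ->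
  positive_op ip (deflate ip T fs) -> exists gs, [/\ size gs = p,
    forall g, g \in gs -> nsq ip g = t & positive_op ip (deflate ip T (gs ++ fs))].
Proof.
move=> sT t0 Tpos; elim: p => [|p [gs [<- gst gspos]]]; first by exists [::].
have [g gt gpos] := spacious_deflate sT t0 gspos.
by exists (g :: gs); split=> // k; rewrite inE => /orP[/eqP->|/gst].
Qed.

(** Take [p] the integer part of [L / beta] and [t = L / p]. Then [beta <= t < beta + beta / p], and
    the lower bound on [L] is what makes [p > beta / (beta' - beta)]. *)
Lemma equal_parts (L beta beta' : R) : 0 < beta -> beta < beta' ->
  beta * (beta / (beta' - beta) + 1) <= L ->
  exists p t, [/\ beta <= t <= beta' & L = t *+ p].
Proof.
move=> b0 bb' hL; have d0 : 0 < beta' - beta by rewrite subr_gt0.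
have Lb : beta / (beta' - beta) + 1 <= L / beta by rewrite ler_pdivlMr // mulrC.
have Lb0 : 0 <= L / beta by apply: le_trans Lb; rewrite addr_ge0 // divr_ge0 // ltW.
have /andP[pl lp] := truncn_itv Lb0; set p := Num.truncn _ in pl lp.
have pge : beta / (beta' - beta) < p%:R.
  by move: lp; rewrite -natr1; lra.
have p0 : 0 < p%:R :> R by apply: le_lt_trans pge; rewrite divr_ge0 // ltW.
exists p, (L / p%:R); split; last by rewrite -(mulr_natr (L / p%:R)) divfK // gt_eqF.
apply/andP; split; first by rewrite ler_pdivlMr // mulrC -ler_pdivlMr.
rewrite ler_pdivrMr //; move: lp; rewrite ltr_pdivrMr // -natr1.
by move: pge; rewrite ltr_pdivrMr // => h1 h2; lra.
Qed.

Lemma mkseqD (I : Type) (f : nat -> I) n m :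
  mkseq f (n + m) = mkseq f n ++ mkseq (fun i => f (n + i)%N) m.
Proof.
rewrite /mkseq iotaD map_cat; congr (_ ++ _).
by rewrite -[X in iota X](addn0 n) iotaDl -map_comp.
Qed.

Section Step.
Variables (S : {linear H -> H}) (c : nat -> R) (beta beta' s : R).
Hypothesis Sspacious : forall t, 0 <= t -> t < s -> spacious ip S t.
Hypothesis c_ge0 : forall i, 0 <= c i.
Hypothesis c_sum : forall n B, exists2 N, (n <= N)%N & B <= \sum_(n <= i < N) c i.
Hypothesis beta_gt0 : 0 < beta.
Hypothesis beta_lt : beta < beta'.
Hypothesis beta_lt_s : beta' < s.

Lemma kill_step fs x : positive_op ip (deflate ip S fs) ->
  (forall i, (size fs <= i)%N -> c i <= beta) ->
  map (nsq ip) fs = mkseq c (size fs) ->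
  exists gs, [/\ gs != [::], positive_op ip (deflate ip S (fs ++ gs)),
    deflate ip S (fs ++ gs) x = 0
    & map (nsq ip) (fs ++ gs) = mkseq c (size (fs ++ gs))].
Proof.
move=> Spos cb fsc.
have [h [hpos hx]] := positive_deflate_kill x Spos.
(* The window of prescribed norms is long enough to pay for [h], whatever its norm, and to leave an
   amount that [equal_parts] can divide. *)
have [N nN LN] := c_sum (size fs) (nsq ip h + beta * (beta / (beta' - beta) + 1)).
have [|p [t [/andP[bt tb'] LE]]] := @equal_parts (\sum_(size fs <= i < N) c i - nsq ip h) _ _ beta_gt0 beta_lt.
  by lra.
have t0 : 0 <= t by apply: le_trans bt; exact: ltW.
have hpos' : positive_op ip (deflate ip S (h :: fs)).
  move=> y; rewrite (@deflate_perm _ _ (fs ++ [:: h])) ?deflate_cat //.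
  by rewrite perm_sym perm_catC.
have [gs [gsp gst gspos]] := spacious_deflate_many p (Sspacious t0 (le_lt_trans tb' beta_lt_s)) t0 hpos'.
pose cs := [seq c i | i <- index_iota (size fs) N].
have [|||fs' fs'c fs'E] := @redistribute _ _ ip cs gs h.
- by move=> d /mapP[i _ ->].
- move=> g d /gst gt dcs; have /mapP[i + ->] : d \in [seq c i | i <- index_iota (size fs) N] by [].
  rewrite mem_index_iota => /andP[ni _].
  by rewrite gt; exact: le_trans (cb _ ni) bt.
- rewrite big_map; have -> : \sum_(g <- gs) nsq ip g = t *+ p.
    rewrite big_seq (eq_bigr (fun=> t)) => [|g /gst//].
    by rewrite -big_seq big_const_seq count_predT gsp iter_addr_0.
  by rewrite -LE addrC subrK.
have defE y : deflate ip S (fs ++ fs') y = deflate ip S (gs ++ h :: fs) y.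
  rewrite (@deflate_perm _ (gs ++ h :: fs) (fs ++ h :: gs)).
    by rewrite /deflate !rank1_sum_cat fs'E.
  by rewrite perm_catC /= -cat_cons -cat1s -catA perm_catCA /= perm_cat2l perm_refl.
have fs'pos : positive_op ip (deflate ip S (fs ++ fs')) by move=> y; rewrite defE.
have sz : size fs' = (N - size fs)%N by rewrite -(size_map (nsq ip)) fs'c size_map size_iota.
exists fs'; split=> //.
(* Nonemptiness makes the lists grow, so that every index of the final sequence is reached. *)
- rewrite -size_eq0 sz subn_eq0 -ltnNge ltn_neqAle nN andbT; apply/eqP => Nfs.
  move: LN; rewrite -Nfs big_geq // leNgt => /negP; apply.
  by rewrite ltr_wpDl ?nsq_ge0 // mulr_gt0 // ltr_wpDl // divr_ge0 // ltW // subr_gt0.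
(* Reordered, the batch first removes [h], after which [x] is killed; removing [gs] can only lower
   the form at [x] from 0, and positivity keeps it there. *)
- apply: (positive_ip_eq0 fs'pos); apply/eqP; rewrite eq_le fs'pos andbT.
  rewrite /= (_ : deflate ip S (fs ++ fs') x = deflate ip (deflate ip (deflate ip S fs) [:: h]) gs x).
    rewrite deflate_quad /= hx ip0l sub0r oppr_le0.
    by apply: sumr_ge0 => g _; rewrite exprn_ge0.
  rewrite defE (@deflate_perm _ _ (fs ++ [:: h] ++ gs)) ?deflate_cat //.
  by rewrite perm_catC /= -cat_cons -cat1s -catA perm_catCA /= perm_cat2l perm_refl.
rewrite map_cat fs'c fsc size_cat sz /mkseq iotaD map_cat; congr (_ ++ _).
Qed.

Lemma exhausting_sequence (x : nat -> H) fs0 : positive_op ip (deflate ip S fs0) ->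
  (forall i, (size fs0 <= i)%N -> c i <= beta) ->
  map (nsq ip) fs0 = mkseq c (size fs0) ->
  exists f : nat -> H, [/\ forall i, nsq ip (f i) = c i,
    forall n, positive_op ip (deflate ip S (mkseq f n))
    & forall k, exists N, deflate ip S (mkseq f N) (x k) = 0].
Proof.
move=> pos0 cb0 c0.
pose ok fs := [/\ positive_op ip (deflate ip S fs), (size fs0 <= size fs)%N
  & map (nsq ip) fs = mkseq c (size fs)].
have step k fs : ok fs -> exists gs, [/\ ok (fs ++ gs), gs != [::]
    & deflate ip S (fs ++ gs) (x k) = 0].
  move=> [fpos fsz fc]; have [i fi|gs [gs0 gpos gx gc]] := @kill_step fs (x k) fpos _ fc.
    by apply: cb0; exact: leq_trans fi.
  by exists gs; split=> //; split=> //; rewrite size_cat (leq_trans fsz) // leq_addr.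
have [nx nxP] : exists nx : nat -> seq H -> seq H, forall k fs, ok fs ->
    [/\ ok (fs ++ nx k fs), nx k fs != [::] & deflate ip S (fs ++ nx k fs) (x k) = 0].
  exists (fun k fs => xget [::] [set gs | [/\ ok (fs ++ gs), gs != [::]
    & deflate ip S (fs ++ gs) (x k) = 0]]).
  by move=> k fs /(step k)/(xgetPex [::]).
pose L := fix L k := if k is k'.+1 then L k' ++ nx k' (L k') else fs0.
have okL k : ok (L k) by elim: k => // k IH; have [] := nxP k (L k) IH.
have LD k m : exists gs, L (k + m)%N = L k ++ gs.
  elim: m => [|m [gs E]]; first by exists [::]; rewrite addn0 cats0.
  by exists (gs ++ nx (k + m)%N (L (k + m)%N)); rewrite addnS /= E catA.
have Lsize k : (k <= size (L k))%N.
  elim: k => // k IH; rewrite /= size_cat; have [_ + _] := nxP k (L k) (okL k).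
  by rewrite -size_eq0 -lt0n => h; rewrite -addn1 leq_add.
(* The lists extend one another and [L k] has at least [k] entries, so the entry [i] exists in
   [L i.+1] and never changes afterwards. *)
pose f i := (L i.+1)`_i.
have Lf k i : (i < size (L k))%N -> (L k)`_i = f i.
  move=> ik; rewrite /f; have [ki|ik'] := leqP k i.+1.
    by have [gs] := LD k (i.+1 - k)%N; rewrite subnKC // => ->; rewrite nth_cat ik.
  have [gs] := LD i.+1 (k - i.+1)%N; rewrite subnKC ?(ltnW ik') // => ->.
  by rewrite nth_cat Lsize.
have mkL k : mkseq f (size (L k)) = L k.
  apply: (@eq_from_nth _ 0); rewrite size_mkseq // => i ik.
  by rewrite nth_mkseq // Lf.
exists f; split=> [i|n|k]; last first.
- by exists (size (L k.+1)); rewrite mkL; have [] := nxP k (L k) (okL k).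
- apply: (@positive_deflate_catl _ _ ip S _ (mkseq (fun i => f (n + i)%N) (size (L n) - n))).
  have -> : mkseq f n ++ mkseq (fun i => f (n + i)%N) (size (L n) - n) = L n.
    by rewrite -mkseqD subnKC ?mkL.
  by have [] := okL n.
have [_ _ E] := okL i.+1; rewrite /f -(nth_map 0 (nsq ip 0)) ?Lsize // E nth_mkseq //.
Qed.

End Step.

(** The operator inequality [T^2 <= M T], again from Cauchy-Schwarz at [x] and [T x]; it turns
    control of the form into control of the vector. *)
Lemma positive_nsq_le T (M : R) x : positive_op ip T -> 0 <= M ->
  (forall y, ip (T y) y <= M%:C * ip y y) -> nsq ip (T x) <= M * complex.Re (ip (T x) x).
Proof.
move=> Tpos M0 TM; have [->|n0] := eqVneq (nsq ip (T x)) 0.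
  by rewrite mulr_ge0 // -ler0c (ReK (Tpos x)).
have np : 0 < nsq ip (T x) by rewrite lt_def n0 nsq_ge0.
have : (nsq ip (T x)) ^+ 2 <= (complex.Re (ip (T x) x)) * (M * nsq ip (T x)).
  rewrite -lecR rmorphXn /= -ipxx -[ip _ _]ger0_norm ?ip_ge0 //.
  apply: le_trans (positive_CauchySchwarz _ _ Tpos) _.
  by rewrite !rmorphM /= -!ipxx (ReK (Tpos x)); apply: ler_wpM2l; rewrite ?TM // Tpos.
by rewrite mulrA expr2 ler_pM2r // mulrC.
Qed.

Lemma quad_le S x : positive_op ip S -> bounded_op S -> ip (S x) x <= (op_norm S)%:C * ip x x.
Proof.
by move=> Spos Sb; rewrite -(ReK (Spos x)) ipxx -rmorphM lecR; exact: op_norm_quad.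
Qed.

Lemma frame_operator_of_exhausting S (f e : nat -> H) : positive_op ip S -> bounded_op S ->
  orthonormal_basis ip e -> (forall n, positive_op ip (deflate ip S (mkseq f n))) ->
  (forall k, exists N, deflate ip S (mkseq f N) (e k) = 0) -> frame_operator ip f S.
Proof.
move=> Spos Sb eB fpos fe x; set M := op_norm S; have M0 : 0 <= M by exact: op_norm_ge0.
have fS n y : ip (deflate ip S (mkseq f n) y) y <= M%:C * ip y y.
  apply: le_trans (quad_le y Spos Sb); rewrite deflate_quad gerBl.
  by apply: sumr_ge0 => g _; rewrite exprn_ge0.
have mono n m y : (n <= m)%N -> deflate ip S (mkseq f n) y = 0 -> deflate ip S (mkseq f m) y = 0.
  move=> nm y0; apply: (positive_ip_eq0 (fpos m)); apply/eqP; rewrite eq_le fpos andbT.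
  rewrite /= -(subnKC nm) mkseqD deflate_cat deflate_quad /= y0 ip0l.
  by rewrite sub0r oppr_le0; apply: sumr_ge0 => g _; rewrite exprn_ge0.
have killed k : exists N, forall n i, (N <= n)%N -> (i < k)%N -> deflate ip S (mkseq f n) (e i) = 0.
  elim: k => [|k [N NP]]; first by exists 0%N.
  have [N' N'k] := fe k; exists (maxn N N') => n i; rewrite geq_max => /andP[Nn N'n].
  rewrite ltnS leq_eqVlt => /orP[/eqP->|ik]; first exact: mono N'n N'k.
  exact: NP.
apply/(cvg_nsqP hip) => eps eps0.
have M1 : 0 < M ^+ 2 + 1 by rewrite ltr_wpDl // sqr_ge0.
have := (@cvg_nsqP _ _ _ hip _ _ _ _ x).1 (eB.2 x) (eps / (M ^+ 2 + 1)) (divr_gt0 eps0 M1).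
move=> [k _ /(_ k (leqnn k)) /= xk]; set y := series _ k in xk.
have [N NP] := killed k; exists N => // n /= Nn.
have -> : S x - series (fun i => ip x (f i) *: f i) n = deflate ip S (mkseq f n) x.
  rewrite /deflate /rank1_sum big_map /series /= /index_iota subn0 //.
have y0 : deflate ip S (mkseq f n) y = 0.
  rewrite /y /series /= (_ : deflate ip S (mkseq f n) _ = \sum_(0 <= i < k) deflate ip S (mkseq f n) (ip x (e i) *: e i)).
    rewrite big_nat big1 // => i /andP[_ ik].
    by rewrite (opZ (deflate ip S (mkseq f n))) /= NP // scaler0.
  exact: (op_sum (deflate ip S (mkseq f n))).
have Tx : deflate ip S (mkseq f n) x = deflate ip S (mkseq f n) (x - y).
  by have /= := opB (deflate ip S (mkseq f n)) x y; rewrite y0 subr0.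
rewrite Tx; apply: le_lt_trans (positive_nsq_le _ (fpos n) M0 (fS n)) _.
have : complex.Re (ip (deflate ip S (mkseq f n) (x - y)) (x - y)) <= M * nsq ip (x - y).
  by rewrite -lecR (ReK (fpos n _)) rmorphM /= -ipxx; exact: fS.
move=> /(ler_wpM2l M0)/le_lt_trans; apply; rewrite mulrA -expr2.
move: xk; rewrite ltr_pdivlMr // mulrDr mulr1 mulrC; have := nsq_ge0 ip (x - y).
lra.
Qed.

(** The frame sum at [x] is [<S x, x>]. The lower bound is [|x|^2 <= M^2 |S x|^2 <= M^2 B <S x, x>],
    with [M] a bound for the inverse; the added ones keep both constants positive. *)
Lemma frame_of_frame_operator S (f : nat -> H) : positive_op ip S -> bounded_op S ->
  invertible_op S -> frame_operator ip f S -> is_frame ip f.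
Proof.
move=> Spos Sb [T [[M TM] ST _]] fS; set B := op_norm S; have B0 : 0 <= B by exact: op_norm_ge0.
have sumE x : (\sum_(i <oo) (rnorm (ip x (f i)) ^+ 2)%:E = (complex.Re (ip (S x) x))%:E)%E.
  apply: cvg_lim => //.
  have := @cvg_Re _ _ _ _ _ _ (@cvg_ip _ _ _ hip _ _ _ _ _ x (fS x)).
  move=> h; rewrite (_ : (fun n => \sum_(0 <= i < n) _)%E =
     (fun n => (complex.Re (ip (series (fun i => ip x (f i) *: f i) n) x))%:E)).
    by apply: cvg_EFin; [exact: nearW|exact: h].
  apply/funext => n; rewrite sumEFin /series /= ip_suml Re_sum; congr EFin.
  apply: eq_bigr => i _; rewrite ipZl ipMC normE -rmorphXn /=.
  by [].
pose C := `|M| ^+ 2 * B + 1; have C0 : 0 < C by rewrite ltr_wpDl // mulr_ge0 // exprn_ge0.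
exists C^-1, (B + 1); split; [by rewrite invr_gt0|by rewrite ltr_wpDl|move=> x].
rewrite sumE !lee_fin -!(nsqE hip); apply/andP; split; last first.
  apply: le_trans (op_norm_quad hip x Sb) _.
  by rewrite ler_wpM2r ?nsq_ge0 // lerDl.
rewrite -ler_pdivlMl ?invr_gt0 // invrK.
have h1 : nsq ip x <= `|M| ^+ 2 * nsq ip (S x).
  rewrite !(nsqE hip) -exprMn ler_pXn2r ?nnegrE ?mulr_ge0 ?rnorm_ge0 //.
  rewrite -{1}(ST x); apply: le_trans (TM _) _.
  by rewrite ler_wpM2r ?rnorm_ge0 // ler_norm.
apply: le_trans h1 _; rewrite /C mulrDl mul1r -mulrA.
have h2 := positive_nsq_le x Spos B0 (fun y => quad_le y Spos Sb).
have h3 : 0 <= complex.Re (ip (S x) x) by rewrite -ler0c (ReK (Spos x)).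
by have := ler_wpM2l (exprn_ge0 2 (normr_ge0 M)) h2; lra.
Qed.

End Exhaust.

(** * Eigenvalues above the essential norm *)

Section Eigen.
Variables (R : realType) (H : completeNormedModType R[i]).
Variable ip : {dot H for Num.conj}.
Hypothesis hip : hilbert_product ip.
Implicit Types (x y z u v w : H) (a b : R[i]).
Implicit Types (us vs fs hs : seq H) (e : nat -> H) (l : nat -> R).
Variable S : {linear H -> H}.
Hypothesis Spos : positive_op ip S.
Hypothesis Sb : bounded_op S.
Local Notation s := (ess_norm S).

(** Only the first [k] values of [e] matter: the sequence is total so that it can be extended by one
    vector at a time. *)
Definition orth_below e k x := forall i, (i < k)%N -> ip x (e i) = 0.

Record top_eigen k e l : Prop := TopEigen {
  top_ortho : forall i j, (i < k)%N -> (j < k)%N -> ip (e i) (e j) = (i == j)%:R ;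
  top_eigenE : forall i, (i < k)%N -> S (e i) = (l i)%:C *: e i ;
  top_ge : forall i, (i < k)%N -> s <= l i ;
  top_max : forall j x, (j < k)%N -> orth_below e j x ->
    complex.Re (ip (S x) x) <= l j * nsq ip x }.

Lemma Re_quad x : (complex.Re (ip (S x) x))%:C = ip (S x) x.
Proof. by rewrite ReK. Qed.

Lemma top_value k e l i : top_eigen k e l -> (i < k)%N ->
  complex.Re (ip (S (e i)) (e i)) = l i.
Proof.
by move=> te ik; rewrite (top_eigenE te ik) ipZl (top_ortho te ik ik) eqxx mulr1.
Qed.

Lemma top_nsq k e l i : top_eigen k e l -> (i < k)%N -> nsq ip (e i) = 1.
Proof. by move=> te ik; rewrite /nsq (top_ortho te ik ik) eqxx. Qed.

Lemma top_nonincreasing k e l i j : top_eigen k e l -> (i <= j)%N -> (j < k)%N -> l j <= l i.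
Proof.
move=> te ij jk; rewrite -(top_value te jk).
have := @top_max _ _ _ te i (e j) (leq_ltn_trans ij jk).
rewrite (top_nsq te jk) mulr1; apply=> i' i'i.
rewrite (top_ortho te jk) ?(ltn_trans i'i) ?(leq_ltn_trans ij) //.
by rewrite gtn_eqF // (leq_trans i'i).
Qed.

Lemma top_orthonormal k e l : top_eigen k e l -> orthonormal ip (mkseq e k).
Proof.
move=> te; apply/andP; split.
  by apply/allP => _ /mapP[i + ->]; rewrite mem_iota add0n => ik; rewrite (top_ortho te) // eqxx.
apply/(pairwiseP 0) => i j; rewrite !inE !size_mkseq => ik jk ij.
by rewrite !nth_mkseq // (top_ortho te) // ltn_eqF.
Qed.

(** The span of the eigenvectors reduces [S], so both the norm and the form split without cross
    terms. *)
Lemma top_quad k e l x (x' := x - rank1_sum ip (mkseq e k) x) : top_eigen k e l ->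
  [/\ orth_below e k x',
    nsq ip x = nsq ip x' + \sum_(i < k) rnorm (ip x (e i)) ^+ 2 &
    complex.Re (ip (S x) x) =
      complex.Re (ip (S x') x') + \sum_(i < k) l i * rnorm (ip x (e i)) ^+ 2].
Proof.
move=> te; have on := top_orthonormal te; rewrite /x'; set p := rank1_sum ip (mkseq e k) x.
have x'o : orth_below e k (x - p).
  by move=> i ik; apply: resid_orth => //; apply/mapP; exists i; rewrite // mem_iota.
have pE : p = \sum_(i < k) ip x (e i) *: e i.
  by rewrite /p /rank1_sum big_map -[k in LHS]subn0 big_mkord.
have ipp y : ip p y = \sum_(i < k) ip x (e i) * ip (e i) y.
  by rewrite pE ip_suml; apply: eq_bigr => i _; rewrite ipZl.
have SpE : S p = \sum_(i < k) (ip x (e i) * (l i)%:C) *: e i.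
  by rewrite pE op_sum; apply: eq_bigr => i _; rewrite opZ (top_eigenE te) // scalerA.
have ipSp y : ip (S p) y = \sum_(i < k) ip x (e i) * (l i)%:C * ip (e i) y.
  by rewrite SpE ip_suml; apply: eq_bigr => i _; rewrite ipZl.
have x'e (i : 'I_k) : ip (e i) (x - p) = 0 by apply: ip_eq0C; exact: x'o.
have px' : ip p (x - p) = 0.
  by rewrite ipp big1 // => i _; rewrite x'e mulr0.
have Spx' : ip (S p) (x - p) = 0.
  by rewrite ipSp big1 // => i _; rewrite x'e mulr0.
have nrm (i : 'I_k) : ip x (e i) * ip (e i) x = (rnorm (ip x (e i)) ^+ 2)%:C.
  by rewrite ipMC normE -rmorphXn.
split=> //.
  apply: (@complexI R); rewrite rmorphD /= -!ipxx rmorph_sum /=.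
  under eq_bigr do rewrite -nrm.
  by rewrite -ipp resid_quad // subrK.
apply: (@complexI R); rewrite rmorphD /= !Re_quad rmorph_sum /=.
have -> : \sum_(i < k) (l i * rnorm (ip x (e i)) ^+ 2)%:C = ip (S p) x.
  rewrite ipSp; apply: eq_bigr => i _; rewrite rmorphM /= -nrm; ring.
have SBx : S x = S (x - p) + S p by rewrite -opD subrK.
rewrite SBx ipDl; congr (_ + _).
have -> : ip (S (x - p)) x = ip (S (x - p)) (x - p) + ip (S (x - p)) p by rewrite -ipDr subrK.
by rewrite (positive_self_adjoint (x - p) p Spos) (ip_eq0C Spx') addr0.
Qed.

(** The new eigenvalue is the supremum [lam] of the form over unit vectors orthogonal to the first
    [k]. Above the essential norm it is attained by [sup_attained]; otherwise
    [lam <= s <= <S z, z> <= lam] and [z] attains it. *)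
Lemma top_extend k e l z : top_eigen k e l -> orth_below e k z -> nsq ip z = 1 ->
  s <= complex.Re (ip (S z) z) ->
  exists e' l', top_eigen k.+1 e' l' /\ complex.Re (ip (S z) z) <= l' k.
Proof.
move=> te zo z1 sz.
pose A := [set complex.Re (ip (S x) x) | x in [set x | orth_below e k x /\ nsq ip x = 1]].
have Aub : has_ubound A.
  exists (op_norm S) => _ [x [_ x1] <-].
  by have := op_norm_quad hip x Sb; rewrite x1 mulr1.
have As : has_sup A by split=> //; exists (complex.Re (ip (S z) z)), z.
set lam := sup A.
have zlam : complex.Re (ip (S z) z) <= lam by apply: ub_le_sup => //; exists z.
have max x : orth_below e k x -> complex.Re (ip (S x) x) <= lam * nsq ip x.
  move=> xo; have [x0|xn0] := eqVneq (nsq ip x) 0.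
    by move/eqP: x0; rewrite nsq_eq0 => /eqP->; rewrite ip0r nsq0 mulr0.
  have n0 : 0 < nsq ip x by rewrite lt_def xn0 nsq_ge0.
  pose r := Num.sqrt (nsq ip x)^-1.
  have rE : r ^+ 2 = (nsq ip x)^-1 by rewrite sqr_sqrtr ?invr_ge0 ?ltW.
  have h : A (complex.Re (ip (S (r%:C *: x)) (r%:C *: x))).
    exists (r%:C *: x) => //=; split; last by rewrite nsqZr rE mulVf.
    by move=> i ik; rewrite ipZl xo // mulr0.
  have := ub_le_sup Aub h; rewrite -/lam -lecR Re_quad opZ ipZl ipZr conj_real mulrA.
  by rewrite -Re_quad -!rmorphM lecR /= -expr2 rE mulrC ler_pdivrMr.
have [x [xo x1 xlam]] : exists x, [/\ orth_below e k x, nsq ip x = 1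
    & complex.Re (ip (S x) x) = lam].
  have [lams|slam] := leP lam s.
    exists z; split=> //; apply/eqP; rewrite eq_le zlam /=.
    exact: le_trans lams sz.
  have [||x [xW x1 xlam]] := @sup_attained _ _ ip hip S lam (mkseq e k) Sb _ slam.
  - move=> y yW; rewrite subr_ge0; apply: max => i ik; apply: yW.
    by apply/mapP; exists i; rewrite // mem_iota.
  - move=> eps eps0; have [_ [y [yo y1] <-] ylam] := sup_adherent eps0 As.
    exists y; split=> //; last by rewrite y1 mulr1 -/lam; move: ylam; rewrite -/lam; lra.
    by move=> v /mapP[i + ->]; rewrite mem_iota add0n => ik; exact: yo.
  exists x; split=> // i ik; apply: xW; apply/mapP; exists i; rewrite // mem_iota //.
(* The compression of [lam - S] to the complement of the first [k] eigenvectors is positive with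
   zero form at [x], hence kills [x]; and [lam x - S x] already lies in that complement, which [S]
   preserves. *)
have xeig : S x = lam%:C *: x.
  pose Q : {linear H -> H} := deflate ip idfun (mkseq e k).
  have on := top_orthonormal te.
  have Qo y : orth_below e k (Q y).
    by move=> i ik; apply: resid_orth => //; apply/mapP; exists i; rewrite // mem_iota.
  have Qid y : orth_below e k y -> Q y = y.
    move=> yo; rewrite /Q /= /deflate rank1_sum_orth ?subr0 //= => v /mapP[i + ->].
    by rewrite mem_iota add0n => ik; exact: yo.
  pose T : {linear H -> H} := Q \o (((lam%:C \*: idfun) \- S) \o Q).
  have QQ u v : ip (Q u) v = ip u (Q v).
    rewrite /Q /= /deflate ipBl ipBr; congr (_ - _); rewrite rank1_sum_ip [RHS]ip_sumr.
    by apply: eq_bigr => w _; rewrite ipZr -ipC mulrC.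
  have TE y : ip (T y) y = (lam * nsq ip (Q y) - complex.Re (ip (S (Q y)) (Q y)))%:C.
    rewrite /T /= QQ ipBl /= ipZl ipxx rmorphB rmorphM /= Re_quad //.
  have Tpos : positive_op ip T.
    by move=> y; rewrite TE ler0c subr_ge0; apply: max; exact: Qo.
  have Tx0 : T x = 0.
    by apply: (positive_ip_eq0 Tpos); rewrite TE Qid // x1 mulr1 xlam subrr.
  have ro : orth_below e k (lam%:C *: x - S x).
    move=> i ik; rewrite ipBl ipZl xo // mulr0 sub0r.
    by rewrite (positive_self_adjoint x (e i) Spos) (top_eigenE te ik) ipZr xo // mulr0 oppr0.
  have : Q (lam%:C *: Q x - S (Q x)) = 0 := Tx0.
  by rewrite (Qid x xo) (Qid _ ro) => /eqP; rewrite subr_eq0 => /eqP.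
exists (fun i => if i == k then x else e i), (fun i => if i == k then lam else l i).
split; last by rewrite eqxx.
have below j y : (j <= k)%N -> orth_below (fun i => if i == k then x else e i) j y ->
    orth_below e j y.
  by move=> jk yo i ij; have := yo i ij; rewrite ltn_eqF // (leq_trans ij).
have lt_of i : (i < k.+1)%N -> i != k -> (i < k)%N.
  by rewrite ltnS leq_eqVlt => /orP[->|].
split=> [i j ik jk|i ik|i ik|j y jk yo].
- case: (eqVneq i k) => ik'; case: (eqVneq j k) => jk'.
  + by rewrite ipxx x1 ik' jk' eqxx.
  + by rewrite xo ?lt_of // ik' eq_sym (negbTE jk').
  + by rewrite (ip_eq0C (xo i _)) ?lt_of // jk' (negbTE ik').
  + by rewrite (top_ortho te) ?lt_of.
- by case: eqVneq => // ik'; rewrite (top_eigenE te) ?lt_of.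
- case: eqVneq => [_|ik']; first exact: le_trans sz zlam.
  by rewrite (top_ge te) ?lt_of.
- have [jk'|jk'] := eqVneq j k; first by apply: max; rewrite -jk'; apply: below yo; rewrite jk'.
  have jk2 := lt_of _ jk jk'.
  exact: (top_max te jk2 (below _ _ (ltnW jk2) yo)).
Qed.

(** While [k < size us], the span of [us] contains a unit vector orthogonal to the [k] eigenvectors
    found; its form is at least [s], which is what [top_extend] asks for. *)
Lemma top_exists us : orthonormal ip us ->
  (forall x, x = rank1_sum ip us x -> s * nsq ip x <= complex.Re (ip (S x) x)) ->
  forall k, (k <= size us)%N -> exists e l, top_eigen k e l.
Proof.
move=> ous sus; elim=> [_|k IH ksz]; first by exists (fun=> 0), (fun=> 0).
have [e [l te]] := IH (ltnW ksz).
have [|x [x0 xE xe]] := @exists_orthogonal _ _ ip us (mkseq e k) ous _.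
  by rewrite size_mkseq.
have n0 : 0 < nsq ip x by rewrite lt_def nsq_ge0 nsq_eq0 x0.
pose r := Num.sqrt (nsq ip x)^-1.
have rE : r ^+ 2 * nsq ip x = 1 by rewrite sqr_sqrtr ?invr_ge0 ?ltW // mulVf // gt_eqF.
have [|||e' [l' [te' _]]] := @top_extend k e l (r%:C *: x) te.
- by move=> i ik; rewrite ipZl xe ?mulr0 //; apply/mapP; exists i; rewrite // mem_iota.
- by rewrite nsqZr.
- have := sus (r%:C *: x); rewrite nsqZr rE mulr1; apply.
  by rewrite (opZ (rank1_sum ip us)) /= -xE.
by exists e', l'.
Qed.

(** A form value above [s] would extend the system to [k.+1] eigenvalues, all above [s]. Some
    nonzero vector in the span of their eigenvectors is orthogonal to the [k] vectors of [us], where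
    the form is at most [s]. *)
Lemma top_complement us k e l : orthonormal ip us -> size us = k ->
  (forall x, (forall u, u \in us -> ip x u = 0) -> complex.Re (ip (S x) x) <= s * nsq ip x) ->
  top_eigen k e l ->
  forall x, orth_below e k x -> complex.Re (ip (S x) x) <= s * nsq ip x.
Proof.
move=> ous usk sus te x xo; rewrite leNgt; apply/negP => sx.
have n0 : 0 < nsq ip x.
  rewrite lt_def nsq_ge0 andbT; apply/eqP => x0; move: sx; rewrite x0 mulr0.
  by move/eqP: x0; rewrite nsq_eq0 => /eqP->; rewrite ip0r ltxx.
pose r := Num.sqrt (nsq ip x)^-1.
have rE : r ^+ 2 * nsq ip x = 1 by rewrite sqr_sqrtr ?invr_ge0 ?ltW // mulVf // gt_eqF.
have r2 : 0 < r ^+ 2 by rewrite sqr_sqrtr ?invr_ge0 ?ltW // invr_gt0.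
have srx : s < complex.Re (ip (S (r%:C *: x)) (r%:C *: x)).
  rewrite -ltcR Re_quad opZ ipZl ipZr conj_real mulrA -Re_quad -!rmorphM /= ltcR -expr2.
  by rewrite -(ltr_pM2l r2) in sx; move: sx; rewrite mulrCA rE mulr1.
have [||e' [l' [te' sl']]] := @top_extend k e l (r%:C *: x) te _ _ (ltW srx).
- by move=> i ik; rewrite ipZl xo // mulr0.
- by rewrite nsqZr.
have {sl'} sl' := lt_le_trans srx sl'.
have [|y [y0 yE yus]] := @exists_orthogonal _ _ ip (mkseq e' k.+1) us (top_orthonormal te') _.
  by rewrite size_mkseq usk.
have yn : 0 < nsq ip y by rewrite lt_def nsq_ge0 nsq_eq0 y0.
have [_ yn2 yS] := top_quad y te'.
rewrite -yE subrr nsq0 add0r in yn2; rewrite -yE subrr ip0r add0r in yS.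
have := sus y yus; rewrite yS leNgt => /negP; apply.
apply: (@lt_le_trans _ _ (l' k * nsq ip y)); first by rewrite ltr_pM2r.
rewrite yn2 mulr_sumr; apply: ler_sum => i _; rewrite ler_wpM2r ?exprn_ge0 ?rnorm_ge0 //.
by apply: (top_nonincreasing te') => //; rewrite -ltnS.
Qed.

(* Ky Fan's maximum principle. *)
Lemma top_U_op k m e l (mu : R) : separable H -> infinite_dimensional H ->
  top_eigen m e l -> (m <= k)%N -> 0 <= mu -> (forall i, (i < m)%N -> mu <= l i) ->
  (forall x, orth_below e m x -> complex.Re (ip (S x) x) <= mu * nsq ip x) ->
  (U_op ip S k <= (\sum_(i < m) l i + mu *+ (k - m))%:E)%E.
Proof.
move=> Hsep Hinf te mk mu0 mul mub.
have [b bB] := exists_orthonormal_basis hip Hsep Hinf.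
apply: ge_ereal_sup => _ [t [P [PP Pk Pt]] <-]; rewrite lee_fin.
have [us [ous usk PE]] := range_dim_rank1_sum PP Pk.
have tE : t = \sum_(u <- us) complex.Re (ip (S u) u).
  apply: (@complexI R); rewrite [RHS]rmorph_sum /=.
  rewrite (has_trace_comp_rank1_sum hip bB Pt (us := us) (S := S)); last by move=> x /=; rewrite PE.
  by apply: eq_bigr => u _; rewrite Re_quad.
(* Summed over an orthonormal list, the weight of each excess [l i - mu] is at most 1, by Bessel
   applied to [e i]. *)
have bnd x : complex.Re (ip (S x) x) <= mu * nsq ip x + \sum_(i < m) (l i - mu) * rnorm (ip x (e i)) ^+ 2.
  have [xo xn xS] := top_quad x te; rewrite xS xn mulrDr -addrA mulr_sumr -big_split /=.
  apply: lerD; first exact: mub.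
  by apply: ler_sum => i _; rewrite mulrBl addrC subrK.
have us1 u : u \in us -> nsq ip u = 1.
  by move=> uus; have /andP[/allP/(_ u uus)/eqP u1 _] := ous; rewrite /nsq u1.
rewrite tE; apply: (@le_trans _ _ (\sum_(u <- us) (mu + \sum_(i < m) (l i - mu) * rnorm (ip u (e i)) ^+ 2))).
  by rewrite big_seq [leRHS]big_seq; apply: ler_sum => u uus; have := bnd u; rewrite us1 // mulr1.
rewrite big_split /= exchange_big /= big_const_seq count_predT iter_addr_0.
have : \sum_(i < m) \sum_(u <- us) (l i - mu) * rnorm (ip u (e i)) ^+ 2 <= \sum_(i < m) (l i - mu).
  apply: ler_sum => i _; rewrite -mulr_sumr ler_piMr ?subr_ge0 ?mul //.
  have := bessel (e i) ous; rewrite ipxx (top_nsq te) // rank1_sum_quad => h.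
  rewrite -lecR rmorph_sum /=; apply: le_trans h; apply: ler_sum => u _.
  by rewrite [ip (e i) u]ipC norm_conjC normE -rmorphXn.
have : mu *+ size us <= mu *+ k by exact: ler_wpMn2l.
rewrite sumrB big_const_ord iter_addr_0 mulrnBr //; lra.
Qed.

Lemma top_eigenS m k e l : (k <= m)%N -> top_eigen m e l -> top_eigen k e l.
Proof.
move=> km te; have lt i : (i < k)%N -> (i < m)%N by move=> ik; exact: leq_trans ik km.
split=> [i j /lt im /lt jm|i /lt im|i /lt im|j x /lt jm].
- exact: (top_ortho te).
- exact: (top_eigenE te).
- exact: (top_ge te).
- exact: (top_max te).
Qed.

Lemma ess_norm_ge0 : 0 <= s.
Proof.
rewrite leNgt; apply/negP => /ess_norm_lt[K _].
by rewrite ltNge op_norm_ge0.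
Qed.

Lemma top_U_op_sum k e l : separable H -> infinite_dimensional H -> (0 < k)%N ->
  top_eigen k e l -> (U_op ip S k <= (\sum_(0 <= i < k) l i)%:E)%E.
Proof.
move=> Hsep Hinf k0 te; have pk : (k.-1 < k)%N by rewrite prednK.
(* Ky Fan's bound is used with [m = k] and [mu] the last eigenvalue, whose multiplicity [k - k] is
   zero. *)
have -> : \sum_(0 <= i < k) l i = \sum_(i < k) l i + l k.-1 *+ (k - k).
  by rewrite subnn mulr0n addr0 big_mkord.
apply: (top_U_op Hsep Hinf te (leqnn k)).
- exact: le_trans ess_norm_ge0 (top_ge te pk).
- by move=> i ik; apply: (top_nonincreasing te) pk; rewrite -ltnS prednK.
by move=> x xo; apply: (top_max te pk) => i ik; apply: xo; exact: ltn_trans ik pk.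
Qed.

Lemma top_positive_deflate k e l (hs := [seq (Num.sqrt (l i))%:C *: e i | i <- iota 0 k]) :
  top_eigen k e l -> positive_op ip (deflate ip S hs).
Proof.
move=> te x; have [_ _ xS] := top_quad x te.
rewrite deflate_quad -Re_quad xS /hs big_map -[k in X in _ - X]subn0 big_mkord rmorphD rmorph_sum /=.
have -> : \sum_(i < k) `|ip x ((Num.sqrt (l i))%:C *: e i)| ^+ 2 =
    \sum_(i < k) (l i * rnorm (ip x (e i)) ^+ 2)%:C.
  apply: eq_bigr => i _; rewrite ipZr conj_real normrM exprMn !normE -!rmorphXn -rmorphM /=.
  rewrite rnorm_real ger0_norm ?sqrtr_ge0 // sqr_sqrtr //.
  by apply: le_trans (top_ge te (ltn_ord i)); exact: ess_norm_ge0.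
by rewrite addrK ReK.
Qed.

End Eigen.

(** * Admissibility *)

Section Admissible.
Variables (R : realType).
Implicit Types (c l : nat -> R).

Lemma U_seq_ge c (s : seq nat) : uniq s -> ((\sum_(i <- s) c i)%:E <= U_seq c (size s))%E.
Proof.
move=> us; apply: ereal_sup_ubound => /=.
have pe : perm_eq s [fset i in s]%fset.
  by apply: uniq_perm => [//||i]; rewrite ?fset_uniq // in_fset.
exists [fset i in s]%fset; first by rewrite /= (perm_size pe).
by rewrite (perm_big _ pe).
Qed.

Lemma eventually_le_of_limn_sup c (b : R) : bounded_fun c -> limn_sup c < b ->
  exists n, forall i, (n <= i)%N -> c i <= b.
Proof.
move=> cb; rewrite limn_supE // => cltb.
have hinf : has_inf (range (sups c)).
  split; first by exists (sups c 0%N), 0%N.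
  have [M Mc] := bounded_fun_has_lbound cb; exists M => _ [n _ <-].
  apply: le_trans (Mc (c n) _) _; first by exists n.
  apply: ub_le_sup; last by exists n => /=.
  exact/has_ubound_sdrop/bounded_fun_has_ubound.
have bpos : 0 < b - inf (range (sups c)) by rewrite subr_gt0.
have [_ [n _ <-]] := inf_adherent bpos hinf.
rewrite addrC subrK => cn; exists n => i ni; apply: le_trans (ltW cn).
apply: ub_le_sup; last by exists i.
exact/has_ubound_sdrop/bounded_fun_has_ubound.
Qed.

Lemma tail_sums_unbounded c : (forall i, 0 <= c i) -> (\sum_(i <oo) (c i)%:E = +oo)%E ->
  forall n B, exists2 N, (n <= N)%N & B <= \sum_(n <= i < N) c i.
Proof.
move=> c0 csum n B; apply: contrapT => no.
have small N : \sum_(0 <= i < N) c i <= \sum_(0 <= i < n) c i + `|B|.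
  have [Nn|nN] := leqP N n.
    rewrite (@big_cat_nat _ _ _ N 0 n) //= -addrA lerDl addr_ge0 //.
    by apply: sumr_ge0.
  rewrite (@big_cat_nat _ _ _ n 0 N) //= ?(ltnW nN) // lerD2l.
  apply: le_trans (ler_norm B); rewrite leNgt; apply/negP => h.
  by apply: no; exists N; [exact: ltnW|exact: ltW].
have : (\sum_(i <oo) (c i)%:E <= (\sum_(0 <= i < n) c i + `|B|)%:E)%E.
  apply: lime_le; first by apply: is_cvg_nneseries => i _ _; rewrite lee_fin.
  by apply: nearW => N; rewrite sumEFin lee_fin.
by rewrite csum leye_eq.
Qed.

(** The largest of 0 and the slopes [(A k - B) / (k - r)] for [r < k <= n]; being finitely many,
    they stay strictly below [s]. *)
Lemma uniform_slack (A : nat -> R) (B s : R) r n : 0 < s ->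
  (forall k, (r < k)%N -> A k < B + s *+ (k - r)) ->
  exists t, [/\ 0 <= t, t < s & forall k, (r < k <= n)%N -> A k <= B + t *+ (k - r)].
Proof.
move=> s0 AB; elim: n => [|n [t [t0 ts tA]]].
  by exists 0; split=> // k /andP[rk]; rewrite leqn0 => /eqP k0; rewrite k0 in rk.
have [nr|rn] := leqP n.+1 r.
  exists t; split=> // k /andP[rk kn]; apply: tA; rewrite rk /=.
  by have := leq_trans rk (leq_trans kn nr); rewrite ltnn.
have d0 : 0 < (n.+1 - r)%:R :> R by rewrite ltr0n subn_gt0.
exists (Num.max t ((A n.+1 - B) / (n.+1 - r)%:R)); split.
- by rewrite le_max t0.
- by rewrite gt_max ts ltr_pdivrMr // ltrBlDl mulr_natr AB.
move=> k /andP[rk]; rewrite leq_eqVlt => /orP[/eqP->|kn].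
  by rewrite -lerBlDl -[leRHS]mulr_natr -ler_pdivrMr // le_max lexx orbT.
apply: le_trans (tA k _) _; first by rewrite rk.
by rewrite lerD2l lerMn2r le_max lexx orbT.
Qed.

Variables (H : completeNormedModType R[i]) (ip : {dot H for Num.conj}).
Hypothesis hip : hilbert_product ip.
Variable S : {linear H -> H}.
Hypothesis Spos : positive_op ip S.
Hypothesis Sb : bounded_op S.
Local Notation s := (ess_norm S).

(** The vectors [sqrt (l i) e i] and [n - m] supply vectors of squared norm [t] can be removed
    together; [schur_horn] replaces them by vectors with the prescribed norms and a form no larger,
    so positivity persists. *)
Lemma initial_batch c m n e l (t : R) : (forall i, 0 <= c i) -> top_eigen ip S m e l ->
  (m <= n)%N -> 0 <= t -> t < s ->
  (forall idx, uniq idx -> (size idx <= n)%N -> \sum_(i <- idx) c i <=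
     \sum_(0 <= i < minn (size idx) m) l i + t *+ (size idx - m)) ->
  exists fs, [/\ size fs = n, map (nsq ip) fs = mkseq c n & positive_op ip (deflate ip S fs)].
Proof.
move=> c0 te mn t0 ts csum.
have Ssp : spacious ip S t by exact: spacious_ess_norm.
pose hm := [seq (Num.sqrt (l i))%:C *: e i | i <- iota 0 m].
have [gs [gsz gst gspos]] := spacious_deflate_many (n - m) Ssp t0 (top_positive_deflate Spos te).
have hmE : map (nsq ip) hm = map l (iota 0 m).
  rewrite -map_comp; apply/eq_in_map => i; rewrite mem_iota add0n => /= im.
  rewrite nsqZr (top_nsq te) // mulr1 sqr_sqrtr //.
  by apply: le_trans (top_ge te im); exact: ess_norm_ge0.
have gsE : map (nsq ip) gs = nseq (n - m) t.
  apply: (@eq_from_nth _ 0); rewrite size_map ?size_nseq // => i ig.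
  by rewrite nth_nseq -gsz ig (nth_map 0) // gst // mem_nth.
pose hs := hm ++ gs.
have hsE : map (nsq ip) hs = map l (iota 0 m) ++ nseq (n - m) t by rewrite map_cat hmE gsE.
have hssz : size hs = n by rewrite size_cat size_map size_iota gsz subnKC.
pose ord := fun i j => c j <= c i.
(* Majorization needs nonincreasing norms; [fs'] below restores the original order, and [deflate]
   does not see the permutation. *)
pose idx := sort ord (iota 0 n).
have pidx : perm_eq idx (iota 0 n) by rewrite perm_sort.
have uidx : uniq idx by rewrite (perm_uniq pidx) iota_uniq.
have szidx : size idx = n by rewrite (perm_size pidx) size_iota.
have [|||||fs fsE fsq] := @schur_horn _ _ ip (map c idx) hs.
- by rewrite size_map szidx hssz.
- by move=> d /mapP[i _ ->].
- by rewrite sorted_map; apply: sort_sorted => i j; exact: le_total.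
- have trans : transitive (fun x y : R => y <= x) by move=> a b d ab bd; exact: le_trans bd ab.
  rewrite hsE sorted_pairwise // pairwise_cat; apply/and3P; split.
  + apply/allrelP => a b /mapP[i + ->]; rewrite mem_iota add0n => im /nseqP[-> _].
    by apply: le_trans (top_ge te im); exact: ltW.
  + apply/(pairwiseP 0) => i j; rewrite !inE !size_map !size_iota => im jm ij.
    rewrite !(nth_map 0%N) ?size_iota // !nth_iota // !add0n.
    exact: top_nonincreasing te (ltnW ij) jm.
  + apply/(pairwiseP 0) => i j; rewrite !inE !size_nseq => im jm ij.
    by rewrite !nth_nseq im jm.
- move=> k; rewrite size_map szidx => kn; rewrite -map_take big_map.
  have szk : size (take k idx) = k by rewrite size_takel // szidx.
  apply: le_trans (csum _ (take_uniq _ uidx) _) _; first by rewrite szk.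
  rewrite szk hsE take_cat size_map size_iota; case: ltnP => km.
    rewrite -map_take take_iota (minn_idPl (ltnW km)) big_map /index_iota subn0.
    by rewrite (_ : (k - m = 0)%N) ?mulr0n ?addr0 //; apply/eqP; rewrite subn_eq0 ltnW.
  rewrite big_cat big_map /= take_nseq ?leq_sub2r // big_nseq iter_addr_0.
  by rewrite /index_iota subn0.
pose fs' := [seq fs`_(index i idx) | i <- iota 0 n].
have szfs : size fs = n by rewrite -(size_map (nsq ip)) fsE size_map.
have pfs : perm_eq fs fs'.
  have {1}<- : [seq fs`_(index i idx) | i <- idx] = fs.
    apply: (@eq_from_nth _ 0) => [|i]; rewrite size_map szidx; first by rewrite szfs.
    by move=> ik; rewrite (nth_map 0%N) ?szidx // index_uniq ?szidx.
  exact: perm_map.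
exists fs'; split; first by rewrite size_map size_iota.
- rewrite /fs' -map_comp; apply/eq_in_map => i; rewrite -(perm_mem pidx) => iidx /=.
  have ii : (index i idx < size idx)%N by rewrite index_mem.
  by rewrite -(nth_map 0 0) ?szfs -?szidx // fsE (nth_map 0%N) // nth_index.
have gsh : perm_eq hs (gs ++ hm) by rewrite perm_catC.
move=> x; rewrite -(deflate_perm ip S x pfs); apply: le_trans (gspos x) _.
by rewrite -(deflate_perm ip S x gsh) /deflate !ipBl lerD2l lerN2.
Qed.

End Admissible.

Theorem theorem5p4 (R : realType) (H : completeNormedModType R[i])
    (ip : {dot H for Num.conj}) (hip : hilbert_product ip)
    (Hsep : separable H) (Hinf : infinite_dimensional H)
    (S : {linear H -> H}) (Sbnd : bounded_op S) (Spos : positive_op ip S)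
    (Sinv : invertible_op S)
    (c : nat -> R) (c_ge0 : forall i, 0 <= c i) (c_bnd : bounded_fun c)
    (c_sum : (\sum_(i <oo) (c i)%:E = +oo)%E)
    (E : set (measurableTypeR R) -> {linear H -> H})
    (SE : spectral_measure ip S E)
    (P2 := E `[ess_norm S, op_norm S]%classic) :
  [/\ infinite_trace ip P2,
      forall k : nat, (0 < k)%N -> (U_seq c k <= U_op ip S k)%E
    & limn_sup c < ess_norm S] \/
  (exists r : nat,
    [/\ has_trace ip P2 r%:R,
        forall k : nat, (1 <= k <= r)%N -> (U_seq c k <= U_op ip S k)%E,
        forall k : nat, (r < k)%N -> (U_seq c k < U_op ip S k)%E
      & limn_sup c < ess_norm S]) ->
  frame_admissible ip S c.
Proof.
move=> hyp; set s := ess_norm S in P2 hyp.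
have limc : limn_sup c < s by case: hyp => [[]//|[r []//]].
pose b0 := (limn_sup c + s) / 2.
have lb : limn_sup c < b0 by rewrite /b0; lra.
have bs : b0 < s by rewrite /b0; lra.
have [n0 cb0] := eventually_le_of_limn_sup c_bnd lb.
have s0 : 0 < s by apply: le_lt_trans bs; exact: le_trans (c_ge0 n0) (cb0 n0 (leqnn _)).
(* Besides its trace, the projection [P2] contributes these two bounds, on its range and on its
   kernel. *)
have spec_ge x : P2 x = x -> s * nsq ip x <= complex.Re (ip (S x) x).
  move=> P2x; apply: (spectral_lower hip SE (D := `[s, op_norm S]%classic)) P2x _ => //.
  by move=> t /=; rewrite !in_itv /= andbT => /andP[].
have spec_le x : P2 x = 0 -> complex.Re (ip (S x) x) <= s * nsq ip x.
  by move=> P2x; apply: (spectral_complement hip SE _ P2x) => y; exact: op_norm_quad.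
have P2proj : orth_proj ip P2 by apply: (spectral_proj SE); exact: measurable_itv.
have U_sum k (idx : seq nat) (z : R) : uniq idx -> size idx = k ->
    (U_seq c k <= z%:E)%E -> \sum_(i <- idx) c i <= z.
  move=> ui <- h; rewrite -lee_fin; apply: le_trans h; exact: U_seq_ge.
have P2sub us x : (forall u, u \in us -> P2 u = u) -> x = rank1_sum ip us x -> P2 x = x.
  move=> usP ->.
  exact: (@subspace_rank1_sum R H ip [set x | P2 x = x] us x (subspace_fix P2) usP).
have U_prefix m e l idx : top_eigen ip S m e l -> uniq idx -> (size idx <= m)%N ->
    ((0 < size idx)%N -> (U_seq c (size idx) <= U_op ip S (size idx))%E) ->
    \sum_(i <- idx) c i <= \sum_(0 <= i < size idx) l i.
  move=> te ui szi Uc; have [k0|kn0] := eqVneq (size idx) 0%N.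
    by rewrite k0 big_geq //; move/size0nil: k0 => ->; rewrite big_nil.
  have kpos : (0 < size idx)%N by rewrite lt0n.
  apply: (U_sum (size idx)) => //; apply: le_trans (Uc kpos) _.
  by apply: top_U_op_sum => //; exact: top_eigenS szi te.
have [n [fs [nn0 szfs fsc fspos]]] : exists n fs, [/\ (n0 <= n)%N, size fs = n,
    map (nsq ip) fs = mkseq c n & positive_op ip (deflate ip S fs)].
  case: hyp => [[trP2 Uc _]|[r [trP2 Uc1 Uc2 _]]].
    have [us [ous usP usn]] := infinite_trace_orthonormal hip n0 Hsep Hinf P2proj trP2.
    have [|e [l te]] := top_exists hip Spos Sbnd ous (fun x xE => spec_ge x (P2sub us x usP xE)) (k := n0).
      by rewrite usn.
    (* There are as many eigenvalues as prescribed norms, so no supply vector is drawn and [t = 0]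
       serves. *)
    have [|fs [szfs fsc fspos]] := initial_batch hip Spos Sbnd (t := 0) c_ge0 te (leqnn n0) (lexx _) s0.
      move=> idx ui szi; rewrite mul0rn addr0 (minn_idPl szi).
      by apply: (U_prefix _ _ _ _ te ui szi) => k0; exact: Uc.
    by exists n0, fs.
  have [us [ous usr PE]] := finite_trace_rank1_sum hip Hsep Hinf P2proj trP2.
  have usP x : x = rank1_sum ip us x -> P2 x = x by move=> {2}->; exact: PE.
  have [|e [l te]] := top_exists hip Spos Sbnd ous (fun x xE => spec_ge x (usP x xE)) (k := r).
    by rewrite usr.
  have below x : orth_below ip e r x -> complex.Re (ip (S x) x) <= s * nsq ip x.
    apply: (top_complement hip Spos Sbnd ous usr _ te) => y yus; apply: spec_le.
    by rewrite PE rank1_sum_orth.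
  (* For [k > r], [U_seq c k] lies strictly below the finite Ky Fan bound with [mu = s], so [fine]
     loses nothing. *)
  pose B := \sum_(i < r) l i; pose A k := fine (U_seq c k).
  have UA k : (r < k)%N -> A k < B + s *+ (k - r) /\ (U_seq c k <= (A k)%:E)%E.
    move=> rk; have lt := lt_le_trans (Uc2 k rk)
      (top_U_op hip Spos Hsep Hinf te (ltnW rk) (ltW s0) (fun i ik => top_ge te ik) below).
    have ge := U_seq_ge c (iota_uniq 0 k); rewrite size_iota in ge.
    have fin : U_seq c k \is a fin_num.
      by rewrite fin_real // (lt_le_trans (ltNyr _) ge) (lt_trans lt (ltry _)).
    by rewrite /A fineK // lexx -lte_fin fineK.
  have [t [t0 ts tA]] := uniform_slack (maxn n0 r) s0 (fun k rk => (UA k rk).1).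
  have [|fs [szfs fsc fspos]] := initial_batch hip Spos Sbnd c_ge0 te (leq_maxr n0 r) t0 ts.
    move=> idx ui szi; have [kr|rk] := leqP (size idx) r.
      rewrite (_ : (size idx - r = 0)%N) ?mulr0n ?addr0; last by apply/eqP; rewrite subn_eq0.
      by apply: (U_prefix _ _ _ _ te ui kr) => k0; apply: Uc1; rewrite k0.
    rewrite big_mkord; apply: le_trans (tA _ _); last by rewrite rk.
    by apply: (U_sum (size idx)) => //; have [] := UA _ rk.
  by exists (maxn n0 r), fs; rewrite leq_maxl.
have [beta [beta' [bpos bb' bs' cbeta]]] : exists beta beta', [/\ 0 < beta, beta < beta', beta' < s
    & forall i, (n0 <= i)%N -> c i <= beta].
  (* The maximum with [s / 2] secures [beta > 0], since [b0] is only known to be nonnegative;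
     [beta'] is halfway from [beta] to [s]. *)
  exists (Num.max b0 (s / 2)), ((Num.max b0 (s / 2) + s) / 2).
  have mlt : Num.max b0 (s / 2) < s by rewrite gt_max bs /=; lra.
  have mge : s / 2 <= Num.max b0 (s / 2) by rewrite le_max lexx orbT.
  split; [lra|lra|lra|move=> i /cb0 h].
  by rewrite le_max h.
have [e eB] := exists_orthonormal_basis hip Hsep Hinf.
have Ssp t : 0 <= t -> t < s -> spacious ip S t by move=> t0 ts; exact: spacious_ess_norm.
have [||f [fc fpos fe]] := exhausting_sequence Ssp c_ge0 (tail_sums_unbounded c_ge0 c_sum)
    bpos bb' bs' e fspos.
- by move=> i; rewrite szfs => ni; apply: cbeta; exact: leq_trans ni.
- by rewrite szfs.
have fS := frame_operator_of_exhausting hip Spos Sbnd eB fpos fe.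
exists f; split=> //; first exact: frame_of_frame_operator fS.
by move=> i; rewrite -(nsqE hip) fc.
Qed.
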